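(* Let $g$ be a locally Lipschitz Lorentzian metric on $\mathbb{R}^n$, fix indices $i,l\in\{1,\dots,n\}$, let $a=g^{il}$ be the $(i,l)$ component of the inverse of $g$, and let $a_\varepsilon=(g*\rho_\varepsilon)^{il}$ be the corresponding component of the inverse of the componentwise convolution $g*\rho_\varepsilon$. Let $f\in L^\infty(\mathbb{R}^n)$ be compactly supported. Then for each compact $K\subseteq\mathbb{R}^n$ and each $1\le j\le n$ (with $\varepsilon$ small enough, depending on $K$, for $a_\varepsilon$ to be defined near $K$): (i) $\big\|\partial_j\big(a_\varepsilon(f*\rho_\varepsilon)-(af)*\rho_\varepsilon\big)\big\|_{L^p(K)}\to0$ as $\varepsilon\to0$ for all $p\in[1,\infty)$, and (ii) there is $C_K>0$ such that $\big\|\partial_j\big(a_\varepsilon(f*\rho_\varepsilon)-(af)*\rho_\varepsilon\big)\big\|_{L^\infty(K)}\le C_K$ for all small $\varepsilon$.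
   Context: $\rho\in C^\infty_c(B_1(0))$ is a nonnegative function on $\mathbb{R}^n$ with unit integral, and $\rho_\varepsilon(x)=\varepsilon^{-n}\rho(x/\varepsilon)$ for $\varepsilon\in(0,1]$; $*$ is convolution on $\mathbb{R}^n$, applied componentwise to tensors. On any compact set, $g*\rho_\varepsilon$ is a smooth Lorentzian (in particular invertible) metric for $\varepsilon$ small, so $a_\varepsilon$ is well defined and smooth there. The constant $C_K$ may depend on $K$, $f$, $g$ and $\rho$, but not on $\varepsilon$. *)

(* Defs.v *)
From HB Require Import structures.
From mathcomp Require Import all_boot all_order all_algebra.
From mathcomp Require Import all_classical all_reals all_analysis.

Set Implicit Arguments.
Unset Strict Implicit.
Unset Printing Implicit Defensive.

Import Order.TTheory GRing.Theory Num.Theory.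
Import numFieldNormedType.Exports.

Local Open Scope classical_set_scope.
Local Open Scope ring_scope.

Definition measure_rV_display : measure_display -> measure_display.
Proof. exact. Qed.

Section measurable_rV.
Context {d : measure_display} {T : measurableType d}.
Variable n : nat.

Let coord (i : 'I_n) (x : 'rV[T]_n) : T := x ord0 i.

Let rV_set0 : g_sigma_preimage coord set0.
Proof. exact: sigma_algebra0. Qed.

Let rV_setC A : g_sigma_preimage coord A -> g_sigma_preimage coord (~` A).
Proof. exact: sigma_algebraC. Qed.

Let rV_bigcup (F : (set 'rV[T]_n)^nat) : (forall i, g_sigma_preimage coord (F i)) ->
  g_sigma_preimage coord (\bigcup_i (F i)).
Proof. exact: sigma_algebra_bigcup. Qed.

HB.instance Definition _ := @isMeasurable.Build (measure_rV_display d)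
  ('rV[T]_n) (g_sigma_preimage coord) rV_set0 rV_setC rV_bigcup.

Lemma measurable_coord (i : 'I_n) :
  measurable_fun [set: 'rV[T]_n] (fun x : 'rV[T]_n => x ord0 i).
Proof.
move=> _ Y mY; rewrite setTI; apply: sub_sigma_algebra => /=.
rewrite -bigcup_seq/=; exists i => /=; first by rewrite mem_index_enum.
by exists Y => //; rewrite setTI.
Qed.

End measurable_rV.

Lemma measurable_fun_rV d1 d2 (T1 : measurableType d1) (T2 : measurableType d2)
    n (f : T1 -> 'rV[T2]_n) :
  (forall i, measurable_fun [set: T1] (fun x => f x ord0 i)) ->
  measurable_fun [set: T1] f.
Proof.
move=> mf.
have sub : (g_sigma_preimage (fun (i : 'I_n) (x : 'rV[T2]_n) => x ord0 i))
   `<=` [set A | measurable (f @^-1` A)].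
  apply: smallest_sub.
    split => /=.
    - by rewrite preimage_set0.
    - by move=> A mA; rewrite setTD preimage_setC; exact: measurableC.
    - by move=> F mF; rewrite preimage_bigcup; exact: bigcup_measurable.
  rewrite -bigcup_seq; apply: bigcup_sub => i _ A [B mB <-] /=.
  rewrite setTI; have := mf i measurableT B mB.
  by rewrite setTI.
by move=> _ A mA; rewrite setTI; exact: sub.
Qed.

(* The library declares this instance, but canonical inference only finds the
   one for products of subprobabilities *)
Lemma sigma_finite_prod d1 d2 (T1 : measurableType d1) (T2 : measurableType d2)
    (R : realType) (m1 : {sigma_finite_measure set T1 -> \bar R})
    (m2 : {sigma_finite_measure set T2 -> \bar R}) :
  sigma_finite setT (m1 \x m2)%E.
Proof.
have /sigma_finiteP[F [TF ndF Foo]] := sigma_finiteT m1.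
have /sigma_finiteP[G [TG ndG Goo]] := sigma_finiteT m2.
exists (fun n => F n `*` G n).
  rewrite -setXTT TF TG predeqE => -[x y]; split.
    move=> [/= [n _ Fnx] [k _ Gky]]; exists (maxn n k) => //; split.
    - by move: x Fnx; exact/subsetPset/ndF/leq_maxl.
    - by move: y Gky; exact/subsetPset/ndG/leq_maxr.
  by move=> [n _ []/= ? ?]; split; exists n.
move=> k; have [? ?] := Foo k; have [? ?] := Goo k.
split; first exact: measurableX.
by rewrite product_measure1E// lte_mul_pinfty// ge0_fin_numE.
Qed.

Section lebesgue_rV.
Context {R : realType}.

Definition cons_rV n (p : measurableTypeR R * 'rV[R]_n) : 'rV[R]_n.+1 :=
  \row_i (if unlift ord0 i is Some j then p.2 ord0 j else p.1).

Definition uncons_rV n (x : 'rV[R]_n.+1) : measurableTypeR R * 'rV[R]_n :=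
  (x ord0 ord0, \row_j x ord0 (lift ord0 j)).

Lemma cons_rVK n : cancel (@cons_rV n) (@uncons_rV n).
Proof.
move=> [a x]; congr pair => /=; first by rewrite mxE unlift_none.
by apply/rowP => j; rewrite !mxE liftK.
Qed.

Lemma measurable_cons_rV n : measurable_fun [set: measurableTypeR R * 'rV[R]_n] (@cons_rV n).
Proof.
apply: measurable_fun_rV => i.
under eq_fun do rewrite mxE.
case: unliftP => [j _|_]; last exact: measurable_fst.
exact: (measurableT_comp (measurable_coord j) measurable_snd).
Qed.

Lemma measurable_uncons_rV n :
  measurable_fun [set: 'rV[R]_n.+1] (@uncons_rV n).
Proof.
apply/measurable_fun_pair => /=; first exact: measurable_coord.
apply: measurable_fun_rV => j; under eq_fun do rewrite mxE.
exact: measurable_coord.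
Qed.

Section step.
Variables (n : nat) (mu : {sigma_finite_measure set 'rV[R]_n -> \bar R}).

Definition lebesgue_rVS : set 'rV[R]_n.+1 -> \bar R :=
  pushforward (lebesgue_measure \x mu)%E (@cons_rV n).

Let lebesgue_rVS0 : lebesgue_rVS set0 = 0%E.
Proof. by rewrite /lebesgue_rVS /pushforward preimage_set0 measure0. Qed.

Let lebesgue_rVS_ge0 A : (0 <= lebesgue_rVS A)%E.
Proof. by rewrite /lebesgue_rVS /pushforward measure_ge0. Qed.

Let lebesgue_rVS_sigma_additive : semi_sigma_additive lebesgue_rVS.
Proof.
pose mcons := @measurable_cons_rV n.
move=> F mF tF mUF; rewrite /lebesgue_rVS /pushforward preimage_bigcup.
apply: measure_semi_sigma_additive.
- by move=> k; rewrite -[X in measurable X]setTI; exact: mcons.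
- apply/trivIsetP => /= i j _ _ ij; rewrite -preimage_setI.
  by move/trivIsetP : tF => /(_ _ _ _ _ ij) ->//; rewrite preimage_set0.
- by rewrite -preimage_bigcup -[X in measurable X]setTI; exact: mcons.
Qed.

HB.instance Definition _ := isMeasure.Build _ _ _ lebesgue_rVS
  lebesgue_rVS0 lebesgue_rVS_ge0 lebesgue_rVS_sigma_additive.

Let lebesgue_rVS_sigma_finite : sigma_finite [set: 'rV[R]_n.+1] lebesgue_rVS.
Proof.
have [F FT mF] := sigma_finite_prod lebesgue_measure mu.
exists (fun k => @uncons_rV n @^-1` F k).
  by rewrite -preimage_bigcup -FT preimage_setT.
move=> k; have [mFk Fkoo] := mF k; split.
  by rewrite -[X in measurable X]setTI; exact: measurable_uncons_rV.
rewrite /lebesgue_rVS /pushforward -comp_preimage.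
by rewrite (_ : _ \o _ = id) //; apply/funext => p; exact: cons_rVK.
Qed.

HB.instance Definition _ := Measure_isSigmaFinite.Build _ _ _ lebesgue_rVS
  lebesgue_rVS_sigma_finite.

End step.

Fixpoint lebesgue_rV n : {sigma_finite_measure set 'rV[R]_n -> \bar R} :=
  match n with
  | 0 => dirac (0 : 'rV[R]_0)
  | m.+1 => lebesgue_rVS (lebesgue_rV m)
  end.

End lebesgue_rV.

Lemma lebesgue_rV_box (R : realType) n (A : 'I_n -> set R) :
  (forall i, measurable (A i)) ->
  lebesgue_rV n [set x : 'rV[R]_n | forall i, A i (x ord0 i)] =
    (\prod_(i < n) lebesgue_measure (A i))%E.
Proof.
elim: n A => [|n IH] A mA.
  rewrite big_ord0 /= diracE mem_set//; first by move=> [].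
rewrite big_ord_recl -IH; last by move=> i; exact: mA.
rewrite /= /lebesgue_rVS /pushforward.
have mB : measurable [set x : 'rV[R]_n | forall i, A (lift ord0 i) (x ord0 i)].
  rewrite (_ : [set _ | _] =
      \bigcap_(i in [set: 'I_n]) ((fun x : 'rV[R]_n => x ord0 i) @^-1` A (lift ord0 i))).
    apply: fin_bigcap_measurable => // i _.
    by rewrite -[X in measurable X]setTI; apply: measurable_coord.
  by apply/seteqP; split=> x /= Ax; [move=> i _|move=> i]; exact: Ax.
rewrite -product_measure1E//; last exact: mA.
apply: (congr1 (lebesgue_measure \x lebesgue_rV n)%E).
apply/seteqP; split=> -[t x] /=.
  move=> Atx; split=> [|i].
    by have := Atx ord0; rewrite mxE unlift_none.
  by have := Atx (lift ord0 i); rewrite mxE liftK.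
by move=> [At Ax] i; rewrite mxE; case: unliftP => [k ->|->].
Qed.

Section mollification.
Context {R : realType} {n : nat}.
Implicit Types (f u v rho : 'rV[R]_n -> R) (g : 'rV[R]_n -> 'M[R]_n).

Definition partial (j : 'I_n) f : 'rV[R]_n -> R :=
  fun x => 'D_(delta_mx ord0 j) f x.

Definition smooth f := forall s : seq 'I_n,
  continuous (foldr partial f s) /\
  forall x j, derivable (foldr partial f s) x (delta_mx ord0 j).

(* The norm of 'rV[R]_n is the sup norm, so its balls are not the Euclidean
   ones *)
Definition euclidean_unit_ball : set 'rV[R]_n :=
  [set x | \sum_i x ord0 i ^+ 2 < 1].

Definition mollifier rho :=
  let supp := closure [set x | rho x != 0] in
  [/\ smooth rho,
      compact supp /\ supp `<=` euclidean_unit_ball,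
      forall x, 0 <= rho x &
      \int[lebesgue_rV n]_x rho x = 1].

Definition rescale rho (e : R) : 'rV[R]_n -> R :=
  fun x => e ^- n * rho (e^-1 *: x).

Definition convolution u v : 'rV[R]_n -> R :=
  fun x => \int[lebesgue_rV n]_y (u y * v (x - y)).

Definition mx_convolution g v : 'rV[R]_n -> 'M[R]_n :=
  fun x => \matrix_(i, j) convolution (fun y => g y i j) v x.

Definition inverse_component g (i l : 'I_n) : 'rV[R]_n -> R :=
  fun x => invmx (g x) i l.

Definition locally_lipschitz g :=
  forall x : 'rV[R]_n, exists2 U : set 'rV[R]_n,
    nbhs x U & [lipschitz g y | y in U].

(* Signature (-, +, ..., +) *)
Definition minkowski_mx : 'M[R]_n :=
  diag_mx (\row_i (if i == 0%N :> nat then -1 else 1)).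

Definition lorentzian_mx (G : 'M[R]_n) :=
  G^T = G /\ exists2 P, P \in unitmx & P^T *m G *m P = minkowski_mx.

(* Members of L^oo are only defined up to null sets, hence so is their
   support *)
Definition ae_compactly_supported f :=
  exists2 C, compact C & {ae lebesgue_rV n, forall x, ~ C x -> f x = 0}.

End mollification.

(* Main.v *)
Require Import Defs.
From mathcomp Require Import all_boot all_order all_algebra.
From mathcomp Require Import all_classical all_reals all_analysis.
From mathcomp Require Import measurable_realfun ess_sup_inf.
From mathcomp Require Import ring lra.

Set Implicit Arguments.
Unset Strict Implicit.
Unset Printing Implicit Defensive.

Import Order.TTheory GRing.Theory Num.Theory.
Import numFieldNormedType.Exports.

Local Open Scope classical_set_scope.
Local Open Scope ring_scope.

(** Write v for the mollifier rescaled to the scale e, w for its j-th partial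
derivative, and a_e for the (i, l) entry of the inverse of g * v. Since
derivatives of convolutions fall on the kernel, the function to be estimated
is T f, where

  T f (x) = (d_j a_e)(x) (f * v)(x) + a_e(x) (f * w)(x) - ((a f) * w)(x)
          = integral of k(x, y) f(y) dy,
  k(x, y) = (d_j a_e)(x) v(x - y) + (a_e(x) - a(y)) w(x - y).

The kernel k vanishes unless |x - y| <= e. The metric is Lipschitz near K, so
that |a_e(x) - a(y)| = O(e) there, and this compensates the extra factor 1/e
in the size of w: hence |k| <= C e^-n. This proves the L^oo bound
([commutator_bounded]).

For the convergence, compare f with its value at x:

  T f (x) = f(x) T 1 (x) + integral of k(x, y) (f(y) - f(x)) dy.

The first term is O(e) uniformly, without any appeal to differentiability of
a: by the identity A^-1 - B^-1 = A^-1 (B - A) B^-1, both d_j a_e and a * w are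
within O(e) of - g(x)^-1 (g * w)(x) g(x)^-1 ([commutator_cst_bound]). The
second term is at most the mean of |f(x - z) - f(x)| over |z| <= e, up to a
constant ([commutator_oscillation]), and its integral over a cube tends to 0
because bounded measurable functions are limits in L^1 of Lipschitz ones
([L1_approximable_bounded], [oscillation_cvg0]). Convergence in L^1 and the
uniform bound give convergence in every L^p, p < oo.

The cubes of the sup norm serve as balls throughout. *)

(** * The sup norm of matrices *)

Section matrix_sup_norm.
Context {R : realType} {m n : nat}.
Implicit Types (M : 'M[R]_(m, n)) (r : R).

Lemma mx_norm_leP M r : 0 <= r -> (forall i j, `|M i j| <= r) <-> `|M| <= r.
Proof.
move=> r0; rewrite [in X in _ <-> X]/Num.norm/= mx_normrE; split=> [Mr|/bigmax_leP[_ Mr] i j].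
  by apply/bigmax_leP; split=> // -[i j] _; exact: Mr.
exact: (Mr (i, j)).
Qed.

Lemma mx_norm_ltP M r : 0 < r -> (forall i j, `|M i j| < r) <-> `|M| < r.
Proof.
move=> r0; rewrite [in X in _ <-> X]/Num.norm/= mx_normrE; split=> [Mr|/bigmax_ltP[_ Mr] i j].
  by apply/bigmax_ltP; split=> // -[i j] _; exact: Mr.
exact: (Mr (i, j)).
Qed.

Lemma le_mx_norm M i j : `|M i j| <= `|M|.
Proof. by move: i j; apply/mx_norm_leP. Qed.

End matrix_sup_norm.

(** * Topology and measurability on row vectors *)

Section measurability.
Context {R : realType} {n : nat}.
Implicit Types (A : set 'rV[R]_n) (r : R).

Let rational_cube (qk : 'rV[rat]_n * nat) : set 'rV[R]_n :=
  [set y | forall i, `|y ord0 i - ratr (qk.1 ord0 i)| < qk.2.+1%:R^-1].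

Lemma measurable_all_coord (P : 'I_n -> set R) : (forall i, measurable (P i)) ->
  measurable [set x : 'rV[R]_n | forall i, P i (x ord0 i)].
Proof.
move=> mP; rewrite (_ : [set _ | _] =
    \bigcap_(i in [set: 'I_n]) ((fun x : 'rV[R]_n => x ord0 i) @^-1` P i)).
  apply: fin_bigcap_measurable => // i _.
  by rewrite -[X in measurable X]setTI; apply: measurable_coord.
by apply/seteqP; split=> x /= Ax; [move=> i _|move=> i]; exact: Ax.
Qed.

(** The sigma-algebra on row vectors is generated by the coordinates; it
contains the open sets because these are countable unions of cubes with
rational centres. *)
Lemma open_measurable_rV A : open A -> measurable A.
Proof.
move=> oA.
have -> : A = \bigcup_(qk in [set qk | rational_cube qk `<=` A]) rational_cube qk.
  apply/seteqP; split=> [x Ax|x [qk qA ?]]; last exact: qA.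
  have /nbhs_ballP[e /= e0 xeA] := open_nbhs_nbhs (conj oA Ax).
  have [k ke] : exists k, k.+1%:R^-1 < e / 2 :> R.
    have e20 : 0 < e / 2 by rewrite divr_gt0.
    have [k _ /(_ k)/(_ (leqnn _)) ke] := near_infty_natSinv_lt (PosNum e20).
    by exists k.
  have /choice[q qx] : forall i : 'I_n, exists q : rat,
      `|x ord0 i - ratr q| < k.+1%:R^-1.
    move=> i; have k0 : 0 < k.+1%:R^-1 :> R by rewrite invr_gt0.
    have : x ord0 i - k.+1%:R^-1 < x ord0 i + k.+1%:R^-1.
      by rewrite ltrBlDr -addrA ltrDl addr_gt0.
    move=> /rat_in_itvoo[q]; rewrite in_itv/= => /andP[q1 q2].
    by exists q; rewrite ltr_distlC q1.
  exists (\row_i q i, k); last by move=> i /=; rewrite mxE.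
  move=> y /= qy; apply: xeA; rewrite -ball_normE/=; apply/mx_norm_ltP => // i0 i.
  rewrite !ord1 !mxE (splitr e); have := qy i; rewrite mxE distrC => yi.
  rewrite -(subrKA (ratr (q i))) (le_lt_trans (ler_normD _ _))// ltrD//.
  - exact: lt_trans (qx i) ke.
  - exact: lt_trans yi ke.
rewrite bigcup_mkcond; apply: countable_bigcupT_measurable => // qk.
case: ifP => // _; apply: (@measurable_all_coord
  (fun i => [set t | `|t - ratr (qk.1 ord0 i)| < qk.2.+1%:R^-1])) => i.
rewrite (_ : [set _ | _] = ball (ratr (qk.1 ord0 i) : R) qk.2.+1%:R^-1).
  by apply: open_measurable; apply: ball_open; rewrite invr_gt0.
by apply/seteqP; split=> t; rewrite -ball_normE /= distrC.
Qed.

Lemma closed_measurable_rV A : closed A -> measurable A.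
Proof.
move=> /closed_openC/open_measurable_rV/measurableC; rewrite setCK; exact.
Qed.

Lemma continuous_measurable_rV (f : 'rV[R]_n -> R) : continuous f ->
  measurable_fun [set: 'rV[R]_n] f.
Proof.
move=> cf; apply: (measurability _ (RGenOpens.measurableE R)) => //.
move=> _ [_ [a [b ->] <-]]; rewrite setTI; apply: open_measurable_rV.
by apply: open_comp => //; move=> x _; exact: cf.
Qed.

End measurability.

(** * Affine changes of variables for the Lebesgue measure *)

Section integration_by_slices.
Context {R : realType}.
Local Open Scope ereal_scope.

Lemma ge0_integral_rVS n (F : 'rV[R]_n.+1 -> \bar R) :
  measurable_fun [set: 'rV[R]_n.+1] F -> (forall x, 0 <= F x) ->
  \int[lebesgue_rV n.+1]_x F x =
  \int[lebesgue_measure]_t \int[lebesgue_rV n]_x F (cons_rV (t, x)).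
Proof.
move=> mF F0.
rewrite -(@fubini_tonelli1 _ _ _ _ _ lebesgue_measure (lebesgue_rV n)
  (F \o @cons_rV R n)); [|by apply: measurableT_comp => //; exact: measurable_cons_rV|by move=> x; exact: F0].
by rewrite /= ge0_integral_pushforward//; exact: measurable_cons_rV.
Qed.

(** Images of half-open intervals under an affine map are intervals, which
determines the image measure. *)
Lemma ge0_integral_affine (c s : R) (F : R -> \bar R) : s != 0%R ->
  measurable_fun [set: R] F -> (forall x, 0 <= F x) ->
  \int[lebesgue_measure]_t F (c + s * t)%R =
  (`|s|^-1)%:E * \int[lebesgue_measure]_t F t.
Proof.
move=> s0 mF F0.
pose phi (t : measurableTypeR R) : measurableTypeR R := (c + s * t)%R.
have mphi : measurable_fun setT phi.
  by apply: measurable_funD => //; apply: measurable_funM.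
have ss0 : (0 <= `|s|)%R by [].
have lebE A : measurable A ->
    lebesgue_measure A = mscale (NngNum ss0) (pushforward lebesgue_measure phi) A.
  apply: lebesgue_measure_unique => _ [[a b] /= ab <-].
  rewrite /mscale /= /pushforward; move: s0; rewrite neq_lt => /orP[s0|s0].
    have -> : phi @^-1` `]a, b] = [set` `[((b - c) / s)%R, ((a - c) / s)%R[].
      apply/seteqP; split=> t; rewrite /phi /= !in_itv/=
        ler_ndivrMr// ltr_ndivlMr// lerBrDl ltrBlDl mulrC andbC//.
    rewrite !lebesgue_measure_itv/= !lte_fin ltr_nM2r ?invr_lt0// ltrD2r.
    case: ifPn => _; last by rewrite mule0.
    rewrite ltr0_norm// -!EFinB -EFinM; congr EFin.
    by field; rewrite lt_eqF.
  have -> : phi @^-1` `]a, b] = [set` `]((a - c) / s)%R, ((b - c) / s)%R]].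
    apply/seteqP; split=> t; rewrite /phi /= !in_itv/=
      ler_pdivlMr// ltr_pdivrMr// lerBrDl ltrBlDl mulrC//.
  rewrite !lebesgue_measure_itv/= !lte_fin ltr_pM2r ?invr_gt0// ltrD2r.
  case: ifPn => _; last by rewrite mule0.
  rewrite gtr0_norm// -!EFinB -EFinM; congr EFin.
  by field; rewrite gt_eqF.
have intE : \int[lebesgue_measure]_t F t =
    \int[mscale (NngNum ss0) (pushforward lebesgue_measure phi)]_t F t.
  by move=> m; apply: eq_measure_integral => A mA _; exact: lebE.
rewrite (intE mphi) ge0_integral_mscale//= ge0_integral_pushforward//=.
by rewrite muleA -EFinM mulVf ?mul1e// normr_eq0.
Qed.

Lemma measurable_affine_rV n (c : 'rV[R]_n) (s : R) :
  measurable_fun [set: 'rV[R]_n] (fun x : 'rV[R]_n => c + s *: x)%R.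
Proof.
apply: measurable_fun_rV => i; under eq_fun do rewrite !mxE.
by apply: measurable_funD => //; apply: measurable_funM => //; exact: measurable_coord.
Qed.

(** By induction on the dimension, one coordinate at a time. It provides
translations and reflections (s = 1, -1) and the normalization of rescaled
mollifiers (s = 1/e). *)
Lemma ge0_integral_rV_affine n (c : 'rV[R]_n) (s : R) (F : 'rV[R]_n -> \bar R) :
  s != 0%R -> measurable_fun [set: 'rV[R]_n] F -> (forall x, 0 <= F x) ->
  \int[lebesgue_rV n]_x F (c + s *: x)%R =
  (`|s|^-1 ^+ n)%:E * \int[lebesgue_rV n]_x F x.
Proof.
move=> s0; elim: n c F => [|n IH] c F mF F0.
  by rewrite expr0 mul1e; apply: eq_integral => x _; rewrite !thinmx0.
rewrite !ge0_integral_rVS//; last first.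
  by apply: measurableT_comp => //; exact: measurable_affine_rV.
have mFcons : measurable_fun setT (F \o @cons_rV R n).
  by apply: measurableT_comp => //; exact: measurable_cons_rV.
have mFt t : measurable_fun setT (fun x : 'rV[R]_n => F (cons_rV (t, x))).
  exact: measurable_fun_pair2 t mFcons.
pose G t := \int[lebesgue_rV n]_x F (cons_rV (t, x)).
have mG : measurable_fun setT G.
  by apply: (measurable_fun_fubini_tonelli_F (F \o @cons_rV R n)) => // x; exact: F0.
have G0 t : 0 <= G t by exact: integral_ge0.
transitivity (\int[lebesgue_measure]_t
    ((`|s|^-1 ^+ n)%:E * G (c ord0 ord0 + s * t)%R)).
  apply: eq_integral => t _; rewrite -(IH (\row_j c ord0 (lift ord0 j)))//.
  apply: eq_integral => x _; congr F; apply/rowP => i; rewrite !mxE.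
  by case: unliftP => [k ->|->]; rewrite ?mxE.
rewrite ge0_integralZl//; last first.
  apply: (measurableT_comp mG).
  by apply: measurable_funD => //; apply: measurable_funM.
by rewrite (ge0_integral_affine (c ord0 ord0) s0 mG)// muleA -EFinM -exprSr.
Qed.

Lemma lebesgue_rV_cube n (r : R) : (0 <= r)%R ->
  lebesgue_rV n [set x : 'rV[R]_n | `|x| <= r]%R = ((2 * r) ^+ n)%:E.
Proof.
move=> r0; rewrite (_ : [set _ | _] =
    [set x : 'rV[R]_n | forall i, [set` `[(- r)%R, r]] (x ord0 i)]); last first.
  apply/seteqP; split=> x /= xr; first by move=> i; rewrite in_itv/= -ler_norml (le_trans (le_mx_norm _ _ _)).
  apply/mx_norm_leP => // i0 i; rewrite ord1 ler_norml; exact: xr.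
rewrite (@lebesgue_rV_box R n (fun=> [set` `[(- r)%R, r]])); last by move=> i; exact: measurable_itv.
rewrite (eq_bigr (fun=> (2 * r)%:E)) => [|i _].
  by rewrite -(big_morph EFin EFinM erefl) prodr_const card_ord.
rewrite lebesgue_measure_itv/= lte_fin; case: ltP => rr.
  by rewrite -EFinB; congr EFin; ring.
by rewrite (_ : r = 0%R) ?mulr0//; lra.
Qed.

End integration_by_slices.

(** * Perturbation of inverse matrices *)

Section invmx_perturbation.
Context {R : realType}.

Lemma mx_norm_mulmx m n p (A : 'M[R]_(m, n)) (B : 'M[R]_(n, p)) :
  `|A *m B| <= n%:R * (`|A| * `|B|).
Proof.
apply/mx_norm_leP => [|i j]; first by rewrite !mulr_ge0.
rewrite mxE (le_trans (ler_norm_sum _ _ _))//.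
rewrite -[X in _ <= X%:R * _]card_ord mulr_natl -sumr_const ler_sum// => k _.
by rewrite normrM ler_pM// le_mx_norm.
Qed.

Lemma invmx_sub n (A B : 'M[R]_n) : A \in unitmx -> B \in unitmx ->
  invmx A - invmx B = invmx A *m (B - A) *m invmx B.
Proof.
by move=> uA uB; rewrite mulmxBr mulVmx// mulmxBl mul1mx -mulmxA mulmxV// mulmx1.
Qed.

Lemma mx_norm_invmx_sub n (A B : 'M[R]_n) : A \in unitmx -> B \in unitmx ->
  `|invmx A - invmx B| <= n%:R ^+ 2 * (`|invmx A| * `|A - B| * `|invmx B|).
Proof.
move=> uA uB; rewrite invmx_sub// (le_trans (mx_norm_mulmx _ _))//.
rewrite expr2 -mulrA ler_wpM2l// mulrA ler_wpM2r//.
by rewrite (le_trans (mx_norm_mulmx _ _))// -opprB normrN.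
Qed.

(** A quantitative Neumann argument: V *m H = 0 forces
V = V *m (G - H) *m invmx G, whose norm is at most half that of V. *)
Lemma unitmx_near n (G H : 'M[R]_n) : G \in unitmx ->
  n%:R ^+ 2 * (`|invmx G| * `|H - G|) <= 2^-1 ->
  H \in unitmx /\ `|invmx H| <= 2 * `|invmx G|.
Proof.
move=> uG small.
have uH : H \in unitmx.
  rewrite -row_free_unit -kermx_eq0; set V := kermx H.
  have VE : V = V *m (G - H) *m invmx G.
    by rewrite mulmxBr mulmx_ker subr0 -mulmxA mulmxV// mulmx1.
  have : `|V| <= 2^-1 * `|V|.
    rewrite {1}VE (le_trans (mx_norm_mulmx _ _))//.
    apply: (@le_trans _ _ (n%:R * (n%:R * (`|V| * `|G - H|) * `|invmx G|))).
      by rewrite ler_wpM2l// ler_wpM2r// mx_norm_mulmx.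
    rewrite (_ : n%:R * _ = n%:R ^+ 2 * (`|invmx G| * `|H - G|) * `|V|).
      by rewrite ler_wpM2r.
    by rewrite distrC; ring.
  have := normr_ge0 V; rewrite -normr_eq0 => V0 V1.
  by rewrite eq_le V0 andbT; lra.
split=> //; have := mx_norm_invmx_sub uH uG.
have : n%:R ^+ 2 * (`|invmx H| * `|H - G| * `|invmx G|) <= 2^-1 * `|invmx H|.
  have -> : n%:R ^+ 2 * (`|invmx H| * `|H - G| * `|invmx G|) =
      n%:R ^+ 2 * (`|invmx G| * `|H - G|) * `|invmx H| by ring.
  by rewrite ler_wpM2r.
have := ler_normD (invmx H - invmx G) (invmx G); rewrite subrK.
by lra.
Qed.

End invmx_perturbation.

(** * Derivative of the inverse of a matrix-valued function *)

Section directional_derivative.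
Context {R : realType} {V : normedModType R}.
Implicit Types (f : V -> R) (x v : V).

Lemma is_derive_cvgP f x v (df : R) :
  is_derive x v f df <->
  h^-1 * (f (h *: v + x) - f x) @[h --> 0^'] --> df.
Proof.
split=> [[dfx <-]|fdf]; first exact: dfx.
split; last exact/cvg_lim.
by apply/cvg_ex; exists df.
Qed.

Lemma is_derive_line_cvg f x v (df : R) : is_derive x v f df ->
  f (h *: v + x) @[h --> 0^'] --> f x.
Proof.
move=> /is_derive_cvgP fdf.
have -> : f x = 0 * df + f x by rewrite mul0r add0r.
have : h * (h^-1 * (f (h *: v + x) - f x)) + f x @[h --> 0^'] --> 0 * df + f x.
  apply: cvgD; last exact: cvg_cst.
  by apply: cvgM => //; apply: (@nbhs_dnbhs _ 0).
apply: cvg_trans; apply: near_eq_cvg; near=> h.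
rewrite mulrA mulfV ?mul1r ?subrK//.
by near: h; exact: nbhs_dnbhs_neq.
Unshelve. all: by end_near. Qed.

Lemma cvg_mulmx_entry m n p (T : Type) (F : set_system T) {FF : Filter F}
    (A : T -> 'M[R]_(m, n)) (B : T -> 'M[R]_(n, p)) (A0 : 'M[R]_(m, n))
    (B0 : 'M[R]_(n, p)) i j :
  (forall i k, A t i k @[t --> F] --> A0 i k) ->
  (forall k j, B t k j @[t --> F] --> B0 k j) ->
  (A t *m B t) i j @[t --> F] --> (A0 *m B0) i j.
Proof.
move=> AA0 BB0; rewrite mxE; under eq_fun do rewrite mxE.
apply: cvg_big => [|k _]; last exact: cvgM.
by move=> z; apply: cvgD; [exact: cvg_fst|exact: cvg_snd].
Qed.

Lemma cvg_mx_norm_sub m n (T : Type) (F : set_system T) {FF : Filter F}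
    (A : T -> 'M[R]_(m, n)) (A0 : 'M[R]_(m, n)) :
  (forall i j, A t i j @[t --> F] --> A0 i j) ->
  `|A t - A0| @[t --> F] --> 0.
Proof.
move=> AA0; apply/cvgrPdist_le => e e0.
have : \forall t \near F, forall ij, `|A t ij.1 ij.2 - A0 ij.1 ij.2| <= e.
  apply: filter_forall => ij; under eq_near do rewrite distrC.
  by have /cvgrPdist_le/(_ _ e0) := AA0 ij.1 ij.2.
apply: filterS => t At; rewrite sub0r normrN normr_id.
by apply/mx_norm_leP => [|i j]; [exact: ltW|rewrite !mxE (At (i, j))].
Qed.

Lemma cvg_invmx n (T : Type) (F : set_system T) {FF : Filter F}
    (A : T -> 'M[R]_n) (A0 : 'M[R]_n) : A0 \in unitmx ->
  `|A t - A0| @[t --> F] --> 0 ->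
  (\forall t \near F, A t \in unitmx) /\ `|invmx (A t) - invmx A0| @[t --> F] --> 0.
Proof.
move=> uA0 AA0; set c := n%:R ^+ 2 * `|invmx A0|.
have cA : c * `|A t - A0| @[t --> F] --> 0.
  by rewrite -[X in _ --> X](mulr0 c); apply: cvgM => //; exact: cvg_cst.
have near_unit : \forall t \near F, A t \in unitmx /\
    `|invmx (A t)| <= 2 * `|invmx A0|.
  have h0 : 0 < 2^-1 :> R by rewrite invr_gt0.
  move/cvgrPdist_le : cA => /(_ _ h0).
  apply: filterS => t; rewrite sub0r normrN => small; apply: unitmx_near => //.
  by rewrite mulrA (le_trans (ler_norm _)).
split; first by apply: filterS near_unit => t [].
have : (2 * `|invmx A0|) * (c * `|A t - A0|) @[t --> F] --> 0.
  rewrite -[X in _ --> X](mulr0 (2 * `|invmx A0|)); apply: cvgM; [exact: cvg_cst|exact: cA].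
apply: (@squeeze_cvgr _ _ _ _ (cst 0)); last exact: cvg_cst.
near=> t; rewrite normr_ge0/=.
have [uAt At] : A t \in unitmx /\ `|invmx (A t)| <= 2 * `|invmx A0| by near: t.
rewrite (le_trans (mx_norm_invmx_sub uAt uA0))// /c.
have -> : 2 * `|invmx A0| * (n%:R ^+ 2 * `|invmx A0| * `|A t - A0|) =
  n%:R ^+ 2 * (2 * `|invmx A0| * `|A t - A0| * `|invmx A0|) by ring.
by rewrite ler_wpM2l// ler_wpM2r// ler_wpM2r.
Unshelve. all: by end_near. Qed.

(** The difference quotient of invmx is computed exactly by [invmx_sub], so that
only the continuity of invmx is needed to pass to the limit. *)
Lemma is_derive_invmx_entry n (G : V -> 'M[R]_n) (G' : 'M[R]_n) x v i l :
  G x \in unitmx ->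
  (forall p q, is_derive x v (fun y => G y p q) (G' p q)) ->
  is_derive x v (fun y => invmx (G y) i l)
    (- (invmx (G x) *m G' *m invmx (G x)) i l).
Proof.
move=> uGx dG; apply/is_derive_cvgP.
have Gx : `|G (h *: v + x) - G x| @[h --> 0^'] --> 0.
  by apply: cvg_mx_norm_sub => p q; exact: is_derive_line_cvg (dG p q).
have [uG invG] := cvg_invmx uGx Gx.
pose Q h : 'M[R]_n := \matrix_(p, q) (h^-1 * (G (h *: v + x) p q - G x p q)).
have : - (invmx (G (h *: v + x)) *m Q h *m invmx (G x)) i l @[h --> 0^'] -->
    - (invmx (G x) *m G' *m invmx (G x)) i l.
  apply: cvgN; apply: cvg_mulmx_entry => [p q|p q]; last exact: cvg_cst.
  apply: cvg_mulmx_entry => [{}p {}q|{}p {}q]; last first.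
    under eq_fun do rewrite mxE.
    by have /is_derive_cvgP := dG p q.
  apply/cvgrPdist_le => e e0; move/cvgrPdist_le : invG => /(_ _ e0).
  apply: filterS => h; rewrite sub0r normrN normr_id => He.
  by have := le_mx_norm (invmx (G (h *: v + x)) - invmx (G x)) p q;
    rewrite !mxE distrC => /le_trans ->.
apply: cvg_trans; apply: near_eq_cvg; near=> h.
have uGh : G (h *: v + x) \in unitmx by near: h.
have -> : Q h = h^-1 *: (G (h *: v + x) - G x) by apply/matrixP => p q; rewrite !mxE.
rewrite -scalemxAr -scalemxAl mxE -mulrN; congr (_ * _).
by rewrite -opprB mulmxN mulNmx -invmx_sub// !mxE opprK.
Unshelve. all: by end_near. Qed.

End directional_derivative.

(** * Uniform bounds for the metric on compact sets *)

Section metric_bounds.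
Context {R : realType} {n : nat}.
Implicit Types (g : 'rV[R]_n -> 'M[R]_n) (K : set 'rV[R]_n).

Lemma lorentzian_unitmx (G : 'M[R]_n) : lorentzian_mx G -> G \in unitmx.
Proof.
move=> [_ [P uP PGP]].
have : minkowski_mx \in @unitmx R n.
  rewrite unitmxE det_diag unitfE; apply/prodf_neq0 => i _; rewrite mxE.
  by case: ifPn; rewrite ?oppr_eq0 oner_neq0.
by rewrite -PGP !unitmx_mul => /andP[/andP[]].
Qed.

(** A single small parameter e plays both roles: e bounds the distance and e^-1
the Lipschitz constant, which turns the compactness argument into a near
covering. *)
Lemma lipschitz_near_compact g K : locally_lipschitz g -> compact K ->
  \forall e \near 0^'+, forall x, K x -> forall y, `|x - y| < e ->
    `|g x - g y| <= e^-1 * `|x - y|.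
Proof.
move=> lg /compact_near_coveringP cK.
pose P e (x : 'rV[R]_n) := forall y, `|x - y| < e -> `|g x - g y| <= e^-1 * `|x - y|.
apply: (cK _ _ P) => x _; have [U Ux] := lg x.
move=> /pinfty_ex_gt0[L L0 gL].
have /nbhs_ballP[d /= d0 xdU] := Ux.
have d20 : 0 < d / 2 by rewrite divr_gt0.
near=> x' e => /= y x'y.
have e0 : 0 < e by [].
have xx' : `|x - x'| < d / 2.
  by near: x'; apply/nbhs_ballP; exists (d / 2) => //= z; rewrite -ball_normE.
have ed : e <= d / 2 by near: e; exact: nbhs_right_le.
have eL : e <= L^-1 by near: e; apply: nbhs_right_le; rewrite invr_gt0.
have /= := gL (x', y); rewrite /= => /(_ _)/le_trans; apply.
  split; apply: xdU; rewrite -ball_normE/=; first by lra.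
  by have := ler_distD x' x y; lra.
by rewrite ler_wpM2r// -[L]invrK lef_pV2// posrE invr_gt0.
Unshelve. all: by end_near. Qed.

Lemma locally_lipschitz_continuous g : locally_lipschitz g -> continuous g.
Proof.
move=> lg x; have [e [e0 ge]] : exists e, 0 < e /\ forall y, `|x - y| < e ->
    `|g x - g y| <= e^-1 * `|x - y|.
  have := lipschitz_near_compact lg (@compact_set1 _ x) => ge.
  near (0:R)^'+ => e; exists e; split=> //.
  by apply: (near ge e) => //.
apply/(@cvgrPdist_lt _ _ _ (nbhs x) _) => r r0.
apply/nbhs_ballP; exists (Num.min e (r * e)) => [|y]; first by rewrite /= lt_min e0 mulr_gt0.
rewrite -ball_normE /= lt_min => /andP[ye yre].
by rewrite (le_lt_trans (ge y ye))// mulrC ltr_pdivrMr.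
Unshelve. all: by end_near. Qed.

Lemma invmx_near_compact g K : continuous g -> (forall x, g x \in unitmx) ->
  compact K -> \forall e \near 0^'+, forall x, K x -> forall H,
    `|H - g x| < e -> H \in unitmx /\ `|invmx H| <= e^-1.
Proof.
move=> cg ug /compact_near_coveringP cK.
pose P e (x : 'rV[R]_n) := forall H, `|H - g x| < e -> H \in unitmx /\ `|invmx H| <= e^-1.
apply: (cK _ _ P) => x _; set M := `|invmx (g x)|.
pose c := n%:R ^+ 2 * M + 1; pose d := (2 * c)^-1.
have c0 : 0 < c by rewrite ltr_pwDr ?ltr01 ?mulr_ge0 ?normr_ge0 ?exprn_ge0 ?ler0n.
have d20 : 0 < d / 2 by rewrite divr_gt0// invr_gt0 mulr_gt0.
have M1 : 0 < 2 * M + 1 by rewrite ltr_pwDr ?ltr01 ?mulr_ge0 ?normr_ge0 ?ler0n.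
near=> x' e => /= H Hx'.
have e0 : 0 < e by [].
have xx' : `|g x' - g x| < d / 2.
  by rewrite distrC; near: x'; apply: cvgr_dist_lt => //; exact: cg.
have ed : e <= d / 2 by near: e; exact: nbhs_right_le.
have eM : e <= (2 * M + 1)^-1.
  by near: e; apply: nbhs_right_le; rewrite invr_gt0.
have [||uH HM] := @unitmx_near _ _ (g x) H; first exact: ug.
  have Hd : `|H - g x| <= d by have := ler_distD (g x') H (g x); lra.
  have -> : 2^-1 = c * d by rewrite /d invfM mulrCA mulfV ?mulr1// gt_eqF.
  by rewrite mulrA -/M ler_pM ?mulr_ge0 ?normr_ge0 ?ler0n// lerDl.
split=> //; rewrite (le_trans HM)// -/M.
apply: (@le_trans _ _ (2 * M + 1)); first by lra.
by rewrite -[2 * M + 1]invrK lef_pV2// posrE invr_gt0.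
Unshelve. all: by end_near. Qed.

Lemma compact_cube (r : R) : compact [set x : 'rV[R]_n | `|x| <= r].
Proof.
apply: bounded_closed_compact.
  exists r; split=> [|M rM x /= xr]; first exact: num_real.
  exact: le_trans xr (ltW rM).
rewrite (_ : [set x | _] = (fun x : 'rV[R]_n => `|x|) @^-1` [set t | t <= r])//.
by apply: closed_comp => [x _|]; [exact: norm_continuous|exact: closed_le].
Qed.

(** All that is used of the metric: near a cube it is Lipschitz with constant L,
and every matrix d-close to one of its values has an inverse bounded by L.
The latter applies to neighbouring values of g and to its mollification. *)
Lemma metric_bounds g (r : R) : locally_lipschitz g ->
  (forall x, g x \in unitmx) -> exists L d : R, [/\ 0 < L, 0 < d,
    forall x, `|x| <= r -> forall y, `|x - y| < d -> `|g x - g y| <= L * `|x - y| &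
    forall x, `|x| <= r -> forall H, `|H - g x| < d ->
      H \in unitmx /\ `|invmx H| <= L].
Proof.
move=> lg ug; have cg := locally_lipschitz_continuous lg.
have near1 := lipschitz_near_compact lg (@compact_cube r).
have near2 := invmx_near_compact cg ug (@compact_cube r).
near (0:R)^'+ => e; exists e^-1, e; split; rewrite ?invr_gt0//.
- exact: (near near1 e).
- exact: (near near2 e).
Unshelve. all: by end_near. Qed.

End metric_bounds.

(** * Approximation of bounded functions by Lipschitz functions *)

Lemma integrable_cst_lty d (T : measurableType d) (R : realType)
    (mu : {measure set T -> \bar R}) (D : set T) (k : R) :
  measurable D -> (mu D < +oo)%E -> mu.-integrable D (EFin \o cst k).
Proof.
move=> mD muD; apply/integrableP; split; first exact/measurable_EFinP.
under eq_integral do rewrite /=.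
by rewrite lebesgue_integral_nonneg.integral_cstr//= lte_mul_pinfty.
Qed.

Section lipschitz_density.
Context {R : realType} {n : nat}.
Variable r : R.
Local Notation mu := (@lebesgue_rV R n).
Implicit Types (u v phi : 'rV[R]_n -> R).

Let B := [set x : 'rV[R]_n | `|x| <= r].

(** Uniformly continuous functions would do as approximants, but explicit
constants are easier to combine under sums and maxima. *)
Definition is_lipschitz phi :=
  exists L : R, forall x y, `|phi x - phi y| <= L * `|x - y|.

Lemma is_lipschitz_continuous phi : is_lipschitz phi -> continuous phi.
Proof.
move=> [L Lphi] x; apply/(@cvgrPdist_lt _ _ _ (nbhs x) _) => e e0.
have M0 : 0 < Num.max L 1 by rewrite lt_max ltr01 orbT.
apply/nbhs_ballP; exists (e / Num.max L 1) => [|y]; first by rewrite /= divr_gt0.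
rewrite -ball_normE /= ltr_pdivlMr// => xy.
rewrite (le_lt_trans (Lphi x y))// (le_lt_trans _ xy)// mulrC ler_wpM2l//.
by rewrite le_max lexx.
Qed.

Lemma is_lipschitz_measurable phi : is_lipschitz phi -> measurable_fun setT phi.
Proof. by move=> /is_lipschitz_continuous/continuous_measurable_rV. Qed.

Lemma measurable_cube : measurable B.
Proof.
apply: closed_measurable_rV; apply: compact_closed; last exact: compact_cube.
exact: norm_hausdorff.
Qed.

Definition L1_approximable u := measurable_fun setT u /\
  forall d : R, 0 < d -> exists2 phi, is_lipschitz phi &
    (\int[mu]_(x in B) `|u x - phi x|%:E <= d%:E)%E.

Lemma measurable_normB u v : measurable_fun setT u -> measurable_fun setT v ->
  measurable_fun B (fun x => `|u x - v x|%:E).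
Proof.
move=> mu_ mv; apply: measurable_funTS; apply/measurable_EFinP.
by apply: measurableT_comp => //; exact: measurable_funB.
Qed.

Lemma le_integral_normD (u u' v v' w w' : 'rV[R]_n -> R) :
  measurable_fun setT u -> measurable_fun setT u' ->
  measurable_fun setT v -> measurable_fun setT v' ->
  measurable_fun setT w -> measurable_fun setT w' ->
  (forall x, `|w x - w' x| <= `|u x - u' x| + `|v x - v' x|) ->
  (\int[mu]_(x in B) `|w x - w' x|%:E <=
   \int[mu]_(x in B) `|u x - u' x|%:E + \int[mu]_(x in B) `|v x - v' x|%:E)%E.
Proof.
move=> mu1 mu2 mv1 mv2 mw1 mw2 uvw; have mB := measurable_cube.
rewrite -ge0_integralD//; try exact: measurable_normB.
apply: ge0_le_integral => //; try exact: measurable_normB.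
  by apply: emeasurable_funD; exact: measurable_normB.
by move=> x _; rewrite -EFinD lee_fin.
Qed.

Lemma L1_approximable_lipschitz u : is_lipschitz u -> L1_approximable u.
Proof.
move=> lu; split=> [|d d0]; first exact: is_lipschitz_measurable.
exists u => //; under eq_integral do rewrite subrr normr0.
by rewrite integral0 lee_fin ltW.
Qed.

(** Covers sums and maxima: both are Lipschitz operations for the l^1 distance,
so that they preserve Lipschitz functions and do not increase the error. *)
Lemma L1_approximable_lift2 (op : R -> R -> R) u v :
  (forall a b a' b', `|op a b - op a' b'| <= `|a - a'| + `|b - b'|) ->
  (measurable_fun setT (fun x => op (u x) (v x))) ->
  L1_approximable u -> L1_approximable v ->
  L1_approximable (fun x => op (u x) (v x)).
Proof.
move=> opP mop [mu_ au] [mv av]; split=> // d d0.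
have d20 : 0 < d / 2 by rewrite divr_gt0.
have [phi lphi uphi] := au _ d20; have [psi lpsi vpsi] := av _ d20.
have lop : is_lipschitz (fun x => op (phi x) (psi x)).
  have [[L Lphi] [M Mpsi]] := (lphi, lpsi); exists (L + M) => x y.
  by rewrite (le_trans (opP _ _ _ _))// mulrDl lerD.
exists (fun x => op (phi x) (psi x)) => //.
rewrite [d]splitr EFinD (le_trans _ (leeD uphi vpsi))//.
by apply: le_integral_normD => //; exact: is_lipschitz_measurable.
Qed.

Lemma L1_approximableD u v : L1_approximable u -> L1_approximable v ->
  L1_approximable (fun x => u x + v x).
Proof.
move=> au av; apply: L1_approximable_lift2 => //.
  by move=> a b a' b'; rewrite opprD addrACA ler_normD.
by apply: measurable_funD; [exact: au.1|exact: av.1].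
Qed.

Lemma L1_approximable_max u v : L1_approximable u -> L1_approximable v ->
  L1_approximable (fun x => Num.max (u x) (v x)).
Proof.
move=> au av; apply: L1_approximable_lift2 => //.
  move=> a b a' b'.
  have := ler_norm (a - a'); have := ler_norm (a' - a); rewrite distrC => h1 h2.
  have := ler_norm (b - b'); have := ler_norm (b' - b); rewrite distrC => h3 h4.
  have := normr_ge0 (a - a'); have := normr_ge0 (b - b') => h5 h6.
  by rewrite ler_norml; case: (ltP a b) => ab; case: (ltP a' b') => ab';
    apply/andP; split; lra.
by apply: measurable_maxr; [exact: au.1|exact: av.1].
Qed.

Lemma L1_approximableZ c u : L1_approximable u -> L1_approximable (fun x => c * u x).
Proof.
move=> [mu_ au]; split=> [|d d0]; first exact: measurable_funM.
have c0 : 0 < `|c| + 1 by rewrite ltr_pwDr.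
have [phi lphi uphi] := au _ (divr_gt0 d0 c0).
have mphi := is_lipschitz_measurable lphi.
exists (fun x => c * phi x).
  have [L Lphi] := lphi; exists (`|c| * L) => x y.
  by rewrite -mulrBr normrM -mulrA ler_wpM2l.
under eq_integral do rewrite -mulrBr normrM EFinM.
rewrite ge0_integralZl//; try exact: measurable_cube; try exact: measurable_normB.
apply: (@le_trans _ _ (`|c|%:E * (d / (`|c| + 1))%:E)%E).
  by rewrite lee_wpmul2l.
rewrite -EFinM lee_fin mulrA ler_pdivrMr// mulrC ler_wpM2l//; first exact: ltW.
by rewrite lerDl.
Qed.

Lemma lty_cube : (mu B < +oo)%E.
Proof.
have [r0|r0] := leP 0 r; first by rewrite /B lebesgue_rV_cube// ltry.
rewrite (_ : B = set0) ?measure0 ?ltry//.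
by apply/seteqP; split=> x //=; rewrite /B /= => xr; have := le_lt_trans xr r0; rewrite normr_lt0.
Qed.

(** Stability under bounded pointwise limits, by dominated convergence. All the
limits needed for density (unions, half-spaces, simple functions) are of this
kind. *)
Lemma L1_approximable_cvg (u_ : nat -> 'rV[R]_n -> R) u (M : R) :
  (forall k, L1_approximable (u_ k)) -> (forall k x, `|u_ k x| <= M) ->
  measurable_fun setT u ->
  (forall x, u_ k x @[k --> \oo] --> u x) -> L1_approximable u.
Proof.
move=> au bu mu_ uu; split=> // d d0.
have d20 : 0 < d / 2 by rewrite divr_gt0.
have iM : mu.-integrable B (EFin \o cst M).
  by apply: integrable_cst_lty; [exact: measurable_cube|exact: lty_cube].
have mf_ k : measurable_fun B (fun x => (u_ k x)%:E).
  by apply/measurable_EFinP/measurable_funTS; exact: (au k).1.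
have mf : measurable_fun B (EFin \o u) by apply/measurable_EFinP/measurable_funTS.
have f_f : {ae mu, forall x, B x -> (u_ k x)%:E @[k --> \oo] --> (u x)%:E}.
  by apply: aeW => x _; apply: cvg_EFin; [exact: nearW|exact: uu].
have f_g : {ae mu, forall x k, B x -> (`|(u_ k x)%:E| <= (EFin \o cst M) x)%E}.
  by apply: aeW => x k _; rewrite lee_fin.
have [_ + _] := dominated_convergence measurable_cube mf_ mf f_f iM f_g.
move=> /fine_cvgP[].
move=> finI /cvgrPdist_le/(_ _ d20) smallI.
have [N [finN smallN]] := filter_ex (filterI finI smallI).
have [phi lphi uphi] := (au N).2 _ d20.
exists phi => //; rewrite [d]splitr EFinD.
have mphi := is_lipschitz_measurable lphi.
apply: (@le_trans _ _ (\int[mu]_(x in B) `|u_ N x - u x|%:E +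
                       \int[mu]_(x in B) `|u_ N x - phi x|%:E)%E).
  apply: le_integral_normD => //; try exact: (au N).1.
  by move=> x; rewrite [`|u_ N x - u x|]distrC ler_distD.
apply: leeD => //; move: finN smallN; rewrite /= => finN.
rewrite sub0r normrN => /(le_trans (ler_norm _)).
by rewrite -lee_fin fineK.
Qed.

Let indic_approximable : set (set 'rV[R]_n) :=
  [set A | measurable A /\ L1_approximable (\1_A : 'rV[R]_n -> R)].

(** Complements are affine images of indicators, finite unions are maxima, and
countable unions are pointwise limits of finite ones. *)
Lemma indic_approximable_sigma_algebra : sigma_algebra setT indic_approximable.
Proof.
split=> [|A [mA aA]|A aA].
- split=> //; rewrite indic0; apply: L1_approximable_lipschitz.
  by exists 0 => x y; rewrite subrr normr0 mul0r.
- split; first by rewrite setTD; exact: measurableC.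
  rewrite (_ : \1__ = fun x => 1 + -1 * \1_A x); last first.
    apply/funext => x; rewrite !indicE setTD in_setC.
    by case: (x \in A); rewrite /= ?mulr1 ?mulr0 ?subrr ?addr0.
  apply: L1_approximableD; last exact: L1_approximableZ.
  apply: L1_approximable_lipschitz.
  by exists 0 => x y; rewrite subrr normr0 mul0r.
have mU := bigcup_measurable (fun k _ => (aA k).1).
split; first exact: mU.
pose U_ k := \big[setU/set0]_(i < k) A i.
apply: (@L1_approximable_cvg (fun k => \1_(U_ k)) _ 1) => //.
- elim=> [|k IH].
    rewrite /U_ big_ord0 indic0; apply: L1_approximable_lipschitz.
    by exists 0 => x y; rewrite subrr normr0 mul0r.
  rewrite (_ : \1__ = fun x => Num.max (\1_(U_ k) x) (\1_(A k) x)); last first.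
    apply/funext => x; rewrite /U_ big_ord_recr/= !indicE in_setU.
    by do 2 case: (x \in _); rewrite /= /Num.max ?ltxx ?ltr01 ?ltr10.
  by apply: L1_approximable_max => //; exact: (aA k).2.
- by move=> k x; rewrite indicE; case: (_ \in _); rewrite ?normr1 ?normr0.
move=> x; apply: cvg_near_cst; have [[i _ Aix]|nAx] := pselect ((\bigcup_k A k) x).
  exists i.+1 => // k /= ik; rewrite !indicE !mem_set//; first by exists i.
  by rewrite /U_ -bigcup_mkord; exists i.
apply: nearW => k; rewrite !indicE !memNset// => Ukx; apply: nAx.
by move: Ukx; rewrite /U_ -bigcup_mkord => -[i _ Aix]; exists i.
Qed.

(** The indicator of the half-space is the limit of the ramps that go from 0 to 1
with slope k. *)
Lemma halfspace_indic_approximable (i : 'I_n) (c : R) :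
  indic_approximable [set x | c < x ord0 i].
Proof.
have mA : measurable [set x : 'rV[R]_n | c < x ord0 i].
  rewrite (_ : [set _ | _] = (fun x : 'rV[R]_n => x ord0 i) @^-1` [set` `]c, +oo[]).
    by rewrite -[X in measurable X]setTI; apply: measurable_coord.
  by apply/seteqP; split=> x /=; rewrite in_itv/= andbT.
split=> //.
pose u_ (k : nat) (x : 'rV[R]_n) := Num.min 1 (Num.max 0 (k%:R * (x ord0 i - c))).
apply: (@L1_approximable_cvg u_ _ 1) => //.
- move=> k; apply: L1_approximable_lipschitz; exists k%:R => x y.
  apply: (@le_trans _ _ `|k%:R * (x ord0 i - c) - k%:R * (y ord0 i - c)|).
    rewrite /u_; set s := _ * _; set t := _ * _.
    have := ler_norm (s - t); have := ler_norm (t - s); rewrite distrC => h1 h2.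
    have := normr_ge0 (s - t) => h3; rewrite ler_norml.
    by case: (ltP 0 s) => ?; case: (ltP 0 t) => ?;
      (try case: (ltP 1 s) => ?); (try case: (ltP 1 t) => ?);
      rewrite ?min_r ?min_l//; apply/andP; split; lra.
  rewrite -mulrBr opprB addrA subrK normrM ger0_norm// ler_wpM2l//.
  by have := le_mx_norm (x - y) ord0 i; rewrite !mxE.
- move=> k x; rewrite /u_ ger0_norm; first by rewrite ge_min lexx.
  by rewrite le_min ler01 le_max lexx.
move=> x; apply: cvg_near_cst; rewrite indicE.
have [xc|cx] := leP (x ord0 i) c.
  apply: nearW => k; rewrite memNset/=; last by rewrite ltNge xc.
  by rewrite /u_ max_l ?min_r// mulr_ge0_le0// subr_le0.
rewrite mem_set//=; near=> k; rewrite /u_.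
have k1 : 1 <= k%:R * (x ord0 i - c).
  by rewrite -ler_pdivrMr ?subr_gt0// mul1r; near: k; exact: nbhs_infty_ger.
by rewrite max_r ?min_l// (le_trans _ k1).
Unshelve. all: by end_near. Qed.

(** The half-spaces generate: first the preimages of Borel sets of the line under
each coordinate, then all measurable sets. *)
Lemma measurable_indic_approximable (A : set 'rV[R]_n) : measurable A ->
  L1_approximable (\1_A : 'rV[R]_n -> R).
Proof.
suff: @measurable _ 'rV[R]_n `<=` indic_approximable by move=> sub /sub[].
apply: smallest_sub; first exact: indic_approximable_sigma_algebra.
rewrite -bigcup_seq; apply: bigcup_sub => i _ _ [Y mY <-] /=; rewrite setTI.
pose S : set (set R) := [set Y | indic_approximable ((fun x : 'rV[R]_n => x ord0 i) @^-1` Y)].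
have [S0 SC SU] := indic_approximable_sigma_algebra.
suff: <<s @RGenOInfty.G R >> `<=` S.
  apply; have : (@RGenOInfty.G R).-sigma.-measurable Y by rewrite -RGenOInfty.measurableE.
  exact.
apply: smallest_sub.
  split=> [|Z SZ|Z SZ]; rewrite /S /=.
  - by rewrite preimage_set0.
  - by rewrite setTD preimage_setC -setTD; exact: SC.
  - by rewrite preimage_bigcup; exact: SU.
move=> _ [c ->]; rewrite /S /=.
have -> : (fun x : 'rV[R]_n => x ord0 i) @^-1` `]c, +oo[%classic = [set x | c < x ord0 i].
  by apply/seteqP; split=> x /=; rewrite in_itv/= andbT.
exact: halfspace_indic_approximable.
Qed.

Import HBNNSimple.

Lemma L1_approximable_sum (I : Type) (s : seq I) (F : I -> 'rV[R]_n -> R) :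
  (forall k, L1_approximable (F k)) ->
  L1_approximable (fun x => \sum_(k <- s) F k x).
Proof.
move=> aF; elim: s => [|k s IH].
  under eq_fun do rewrite big_nil.
  by apply: L1_approximable_lipschitz; exists 0 => x y; rewrite subrr normr0 mul0r.
by under eq_fun do rewrite big_cons; exact: L1_approximableD.
Qed.

Lemma L1_approximable_nnsfun (h : {nnsfun 'rV[R]_n >-> R}) : L1_approximable h.
Proof.
rewrite (_ : (h : _ -> _) = fun x => \sum_(y <- finmap.enum_fset (fset_set (range h))) y * \1_(h @^-1` [set y]) x).
  apply: L1_approximable_sum => y; apply: L1_approximableZ.
  exact: measurable_indic_approximable.
by apply/funext => x; rewrite fimfunE fsbig_finite.
Qed.

Lemma L1_approximable_bounded u (M : R) : measurable_fun setT u ->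
  (forall x, `|u x| <= M) -> L1_approximable u.
Proof.
move=> mu_ uM.
have pos (w : 'rV[R]_n -> R) : measurable_fun setT w -> (forall x, 0 <= w x <= M) -> L1_approximable w.
  move=> mw wM; have mEw : measurable_fun setT (EFin \o w) by exact/measurable_EFinP.
  pose h := nnsfun_approx measurableT mEw.
  have h_cvg x : (EFin \o h ^~ x) @ \oo --> (w x)%:E.
    apply: cvg_nnsfun_approx => // y _; rewrite lee_fin.
    by have /andP[] := wM y.
  have h_le k x : h k x <= w x.
    rewrite -lee_fin /h nnsfun_approxE.
    by apply: measurable_fun_approximation.le_approx => // y _; rewrite lee_fin; have /andP[] := wM y.
  apply: (@L1_approximable_cvg (fun k => h k) _ M) => //.
  - by move=> k; exact: L1_approximable_nnsfun.
  - move=> k x; rewrite ger0_norm//; have /andP[_] := wM x; exact: le_trans.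
  - by move=> x; move: (h_cvg x) => /fine_cvgP[].
rewrite (_ : u = fun x => Num.max (u x) 0 + -1 * Num.max (- u x) 0); last first.
  by apply/funext => x; case: (ltP (u x) 0) => ?; case: (ltP (- u x) 0) => ?; lra.
apply: L1_approximableD; last apply: L1_approximableZ; apply: pos.
- exact: measurable_maxr.
- by move=> x; have := uM x; rewrite ler_norml le_max ge_max lexx orbT/=; lra.
- by apply: measurable_maxr => //; exact: measurableT_comp.
- by move=> x; have := uM x; rewrite ler_norml le_max ge_max lexx orbT/=; lra.
Qed.

End lipschitz_density.

(** * Convolution with bounded kernels supported in small cubes *)

Section convolution_kernels.
Context {R : realType} {n : nat}.
Local Notation mu := (@lebesgue_rV R n).
Implicit Types (u v w : 'rV[R]_n -> R) (x y d : 'rV[R]_n) (C e r M : R).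

Definition locally_bounded u :=
  measurable_fun setT u /\ forall r, exists M, forall x, `|x| <= r -> `|u x| <= M.

(** Size and support are all that the estimates use of a mollifier and of its
derivative; C and e carry their dependence on the scale. *)
Definition kernel C e v :=
  [/\ measurable_fun setT v, forall x, `|v x| <= C & forall x, v x != 0 -> `|x| <= e].

Lemma continuous_bounded_cube u r : continuous u ->
  exists M, forall x, `|x| <= r -> `|u x| <= M.
Proof.
move=> cu.
have /compact_bounded[M [_ uM]] : compact (u @` [set x | `|x| <= r]).
  apply: continuous_compact; last exact: compact_cube.
  exact: continuous_subspaceT.
exists (M + 1) => x xr; apply: (uM (M + 1)); first by rewrite ltrDl.
by exists x.
Qed.

Lemma continuous_locally_bounded u : continuous u -> locally_bounded u.
Proof.
move=> cu; split; first exact: continuous_measurable_rV.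
by move=> r; exact: continuous_bounded_cube.
Qed.

Lemma locally_bounded_cst c : locally_bounded (fun=> c).
Proof. by split=> // r; exists `|c|. Qed.

Lemma locally_boundedM u v : locally_bounded u -> locally_bounded v ->
  locally_bounded (fun x => u x * v x).
Proof.
move=> [mu_ bu] [mv bv]; split=> [|r]; first exact: measurable_funM.
have [M uM] := bu r; have [N vN] := bv r; exists (M * N) => x xr.
by rewrite normrM ler_pM// ?uM ?vN.
Qed.

Lemma measurable_reflect v x : measurable_fun setT v ->
  measurable_fun setT (fun y => v (x - y)).
Proof.
move=> mv; rewrite (_ : (fun y => _) = v \o (fun y => x + -1 *: y)); last first.
  by apply/funext => y; rewrite /= scaleN1r.
by apply: measurableT_comp => //; exact: measurable_affine_rV.
Qed.

Lemma ge0_integral_reflect x (F : 'rV[R]_n -> \bar R) :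
  measurable_fun setT F -> (forall y, 0 <= F y)%E ->
  (\int[mu]_y F (x - y)%R = \int[mu]_y F y)%E.
Proof.
move=> mF F0; under eq_integral do rewrite -scaleN1r.
rewrite (ge0_integral_rV_affine x _ mF F0) ?oppr_eq0 ?oner_neq0//.
by rewrite normrN1 invr1 expr1n mul1e.
Qed.

Lemma cube_integral_indic e : 0 <= e ->
  (\int[mu]_z (\1_[set z : 'rV[R]_n | `|z| <= e] z)%:E = ((2 * e) ^+ n)%:E)%E.
Proof.
move=> e0; rewrite integral_indic ?setIT//; last exact: measurable_cube.
exact: lebesgue_rV_cube.
Qed.

(** The indicator is written as a function of x - y because this is how kernels
occur in convolutions. *)
Lemma integral_cube_bound w x e M : 0 <= e -> measurable_fun setT w ->
  (forall y, `|w y| <= M * \1_[set z : 'rV[R]_n | `|z| <= e] (x - y)) ->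
  mu.-integrable setT (EFin \o w) /\ `|\int[mu]_y w y| <= M * (2 * e) ^+ n.
Proof.
move=> e0 mw wM.
have M0 : 0 <= M.
  have := wM x; rewrite subrr indicE mem_set ?mulr1; last by rewrite /= normr0.
  exact: le_trans.
pose Q := [set z : 'rV[R]_n | `|z| <= e].
have m1 : measurable_fun setT (\1_Q : 'rV[R]_n -> R).
  by apply: measurable_indic; exact: measurable_cube.
have m2 : measurable_fun setT (fun y => \1_Q (x - y) : R) by exact: measurable_reflect.
have absw : (\int[mu]_y `|w y|%:E <= (M * (2 * e) ^+ n)%:E)%E.
  rewrite EFinM -cube_integral_indic//.
  rewrite -(@ge0_integral_reflect x (EFin \o \1_Q)); [|exact/measurable_EFinP|by move=> y; rewrite lee_fin].
  rewrite -ge0_integralZl//; last 2 first.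
  - exact/measurable_EFinP.
  - by move=> y _; rewrite /= lee_fin.
  apply: ge0_le_integral => //.
  - by apply/measurable_EFinP; exact: measurableT_comp.
  - by apply/measurable_EFinP; exact: measurable_funM.
  - by move=> y _; rewrite /= -EFinM lee_fin.
have iw : mu.-integrable setT (EFin \o w).
  apply/integrableP; split; first exact/measurable_EFinP.
  by rewrite (le_lt_trans absw)// ltry.
split=> //; rewrite (le_trans (le_normr_Rintegral _ iw))//.
rewrite -lee_fin; apply: (le_trans _ absw).
rewrite /Rintegral fineK// ge0_fin_numE; last exact: integral_ge0.
by rewrite (le_lt_trans absw)// ltry.
Qed.

Lemma convolution_bound u v x C e M : 0 <= e -> locally_bounded u -> kernel C e v ->
  (forall y, `|x - y| <= e -> `|u y| <= M) ->
  mu.-integrable setT (fun y => (u y * v (x - y))%:E) /\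
  `|convolution u v x| <= M * C * (2 * e) ^+ n.
Proof.
move=> e0 [mu_ _] [mv vC ve] uM.
apply: (@integral_cube_bound (fun y => u y * v (x - y)) x) => //.
  by apply: measurable_funM => //; exact: measurable_reflect.
move=> y; have [xye|xye] := leP `|x - y| e.
  by rewrite indicE mem_set// mulr1 normrM ler_pM// uM.
rewrite indicE memNset ?mulr0//=; last by apply/negP; rewrite -ltNge.
have [->|/ve] := eqVneq (v (x - y)) 0; first by rewrite mulr0 normr0.
by rewrite leNgt xye.
Qed.

Lemma convolution_integrable u v x C e : 0 <= e -> locally_bounded u -> kernel C e v ->
  mu.-integrable setT (fun y => (u y * v (x - y))%:E).
Proof.
move=> e0 bu kv; have [M uM] := bu.2 (`|x| + e).
apply: (convolution_bound (M := M) e0 bu kv _).1 => y xye; apply: uM.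
by have := ler_distD x 0 y; rewrite !sub0r !normrN; lra.
Qed.

(** Differentiation under the integral sign along the line through x directed by
d; for |t| < 1 all the integrands are supported in one fixed cube. *)
Lemma is_derive_convolution u v w x d C C' e : 0 <= e -> locally_bounded u ->
  kernel C e v -> kernel C' e w -> (forall z, is_derive z d v (w z)) ->
  is_derive x d (convolution u v) (convolution u w x).
Proof.
move=> e0 bu kv kw vw; apply/is_derive_cvgP.
pose f (t : R) y := u y * v (x + t *: d - y).
have [mw wC we] := kw.
have fder t y : is_derive (t : R) 1 (f ^~ y) (u y * w (x + t *: d - y)).
  apply/is_derive_cvgP; have /is_derive_cvgP vd := vw (x + t *: d - y).
  under eq_fun do rewrite -mulrBr mulrCA.
  apply: cvgM; first exact: cvg_cst.
  rewrite (_ : (fun h => _) = fun h => h^-1 * (v (h *: d + (x + t *: d - y)) - v (x + t *: d - y)))//.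
  apply/funext => h; rewrite scaler1 scalerDl; congr (_ * (v _ - _)).
  by rewrite addrCA !addrA.
(* y cannot be farther than this from 0 if x + t *: d - y is in the support. *)
pose r := `|x| + `|d| + e.
have [M uM] := bu.2 r.
pose G y := `|M| * C' * \1_[set z : 'rV[R]_n | `|z| <= r] y.
have r0 : 0 <= r by rewrite !addr_ge0.
have C'0 : 0 <= C' by exact: le_trans (normr_ge0 _) (wC 0).
have G0 y : 0 <= G y by rewrite !mulr_ge0.
have d1 t y : partial1of2 f t y = u y * w (x + t *: d - y).
  by rewrite partial1of2E; exact: derive_val.
have intG : mu.-integrable setT (EFin \o G).
  have mQ := @measurable_cube R n r.
  by apply: (integral_cube_bound (x := 0) (e := r) (M := `|M| * C') _ _ _).1 => //;
    [apply: measurable_funM => //; exact: measurable_indic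
    |move=> y; rewrite ger0_norm// sub0r /G !indicE; rewrite le_eqVlt; apply/orP; left; apply/eqP;
      congr (_ * (nat_of_bool _)%:R); apply/idP/idP; rewrite !inE /= normrN].
have I0 : `](-1), 1[%classic (0 : R) by rewrite /= in_itv/= oppr_lt0 ltr01.
have intf t : `](-1), 1[%classic t -> mu.-integrable setT (EFin \o f t).
  by move=> _; exact: convolution_integrable kv.
have derf t y : `](-1), 1[%classic t -> setT y -> derivable (f ^~ y) t 1.
  by move=> _ _; exact: ex_derive.
have G_ub t y : `](-1), 1[%classic t -> setT y -> `|partial1of2 f t y| <= G y.
  move=> /= /[!in_itv]/= /andP[t1 t2] _; rewrite d1.
  have [->|/we xyt] := eqVneq (w (x + t *: d - y)) 0; first by rewrite mulr0 normr0.
  have td : `|t *: d| <= `|d|.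
    by rewrite normrZ ler_piMl// ler_norml !ltW.
  have yr : `|y| <= r.
    have := ler_normB (x + t *: d) (x + t *: d - y); rewrite subKr.
    have := ler_normD x (t *: d); rewrite /r; lra.
  rewrite /G indicE mem_set// mulr1 normrM ler_pM//.
  exact: le_trans (uM _ yr) (ler_norm _).
have := cvg_differentiation_under_integral measurableT I0 intf derf G0 intG G_ub.
have -> : \int[mu]_y partial1of2 f 0 y = convolution u w x.
  by apply: eq_Rintegral => y _; rewrite d1 scale0r addr0.
apply: cvg_trans; apply: near_eq_cvg; apply: nearW => h.
rewrite addr0; congr (_ * (_ - _)); apply: eq_Rintegral => y _; rewrite /f ?scale0r ?addr0//.
by rewrite [x + _]addrC.
Qed.

End convolution_kernels.

(** * Mollifiers and their derivatives as kernels *)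

Section mollifier_kernels.
Context {R : realType} {n : nat}.
Local Notation mu := (@lebesgue_rV R n).
Implicit Types (u v w rho : 'rV[R]_n -> R) (x y d : 'rV[R]_n) (C e : R).

Lemma euclidean_unit_ball_norm x : euclidean_unit_ball x -> `|x| <= 1.
Proof.
move=> x1; apply/mx_norm_leP => // i0 i; rewrite ord1.
have : x ord0 i ^+ 2 <= 1.
  apply: le_trans (ltW x1); rewrite (bigD1 i)//= lerDl sumr_ge0// => k _.
  exact: sqr_ge0.
by rewrite -real_normK ?num_real// expr_le1.
Qed.

Lemma continuous_kernel v : continuous v -> (forall x, v x != 0 -> `|x| <= 1) ->
  exists C, kernel C 1 v.
Proof.
move=> cv v1; have [C vC] := continuous_bounded_cube 1 cv.
exists C; split=> //; first exact: continuous_measurable_rV.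
move=> x; have [x1|x1] := leP `|x| 1; first exact: vC.
have [->|/v1] := eqVneq (v x) 0; last by rewrite leNgt x1.
by rewrite normr0 (le_trans _ (vC 0 _))// normr0.
Qed.

(** Where v vanishes on a neighbourhood, so does its derivative. *)
Lemma partial_support j v x : partial j v x != 0 -> closure [set z | v z != 0] x.
Proof.
move=> /eqP px; apply: contrapT => nx; apply: px.
have v0 : \forall z \near x, v z = 0.
  have oC : open (~` closure [set z | v z != 0]) by apply/closed_openC/closed_closure.
  apply: filterS (open_nbhs_nbhs (conj oC nx)) => z nz.
  by apply/eqP/negPn/negP => vz; apply: nz; exact: subset_closure.
suff : is_derive x (delta_mx ord0 j) v 0 by move=> ?; exact: derive_val.
have vx := nbhs_singleton v0; apply/is_derive_cvgP; apply: cvg_near_cst.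
have line : h *: (delta_mx ord0 j : 'rV[R]_n) + x @[h --> (0 : R)^'] --> x.
  have e0 : x = 0 *: (delta_mx ord0 j : 'rV[R]_n) + x by rewrite scale0r add0r.
  rewrite [X in _ --> X]e0; apply: cvgD; last exact: cvg_cst.
  by apply: cvgZr_tmp; apply: (@nbhs_dnbhs _ 0).
near=> h; have -> : v (h *: delta_mx ord0 j + x) = 0 by near: h; exact: (line _ v0).
by rewrite vx subrr mulr0.
Unshelve. all: by end_near. Qed.

Lemma mollifier_kernel rho : mollifier rho -> exists C, kernel C 1 rho.
Proof.
move=> [srho [_ supp1] _ _]; apply: continuous_kernel; first exact: (srho [::]).1.
move=> x rx; apply/euclidean_unit_ball_norm/supp1.
exact: subset_closure.
Qed.

Lemma partial_mollifier_kernel j rho : mollifier rho ->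
  exists C, kernel C 1 (partial j rho).
Proof.
move=> [srho [_ supp1] _ _]; apply: continuous_kernel; first exact: (srho [:: j]).1.
by move=> x rx; apply/euclidean_unit_ball_norm/supp1/(partial_support rx).
Qed.

Lemma rescale_kernel v C e : 0 < e -> kernel C 1 v ->
  kernel (C * e ^- n) e (rescale v e).
Proof.
move=> e0 [mv vC v1]; split.
- apply: measurable_funM => //; apply: (measurableT_comp mv).
  by have := measurable_affine_rV (0 : 'rV[R]_n) e^-1; under eq_fun do rewrite add0r.
- move=> x; rewrite normrM mulrC ler_pM//.
  by rewrite ger0_norm// invr_ge0 exprn_ge0// ltW.
- move=> x; rewrite mulf_eq0 negb_or => /andP[_ /v1].
  by rewrite normrZ gtr0_norm ?invr_gt0// ler_pdivrMl// mulr1.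
Qed.

Lemma is_derive_rescale v w d e : 0 < e -> (forall z, is_derive z d v (w z)) ->
  forall z, is_derive z d (rescale v e) (e^-1 * rescale w e z).
Proof.
move=> e0 vw z; apply/is_derive_cvgP; have /is_derive_cvgP vd := vw (e^-1 *: z).
have eV0 : e^-1 != 0 by rewrite invr_eq0 gt_eqF.
have scaled : e^-1 * h @[h --> (0 : R)^'] --> (0 : R)^'.
  have c0 : e^-1 * h @[h --> (0 : R)] --> (0 : R).
    by rewrite -[X in _ --> X](mulr0 e^-1); apply: cvgMl_tmp.
  move=> A A0; have A1 : nbhs (0 : R) [set z | z != 0 -> A z] by exact: A0.
  have A2 : \forall h \near (0 : R), e^-1 * h != 0 -> A (e^-1 * h) by exact: c0 _ A1.
  suff : nbhs (0 : R) [set h | h != 0 -> A (e^-1 * h)] by [].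
  by apply: filterS A2 => h /= Ah h0; apply: Ah; rewrite mulf_neq0.
have := cvg_comp _ _ scaled vd; rewrite /rescale => qd.
have : e^-1 * (e ^- n * ((e^-1 * h)^-1 *
    (v ((e^-1 * h) *: d + e^-1 *: z) - v (e^-1 *: z)))) @[h --> (0 : R)^'] -->
    e^-1 * (e ^- n * w (e^-1 *: z)).
  apply: cvgM; first exact: cvg_cst.
  by apply: cvgM; first exact: cvg_cst.
apply: cvg_trans; apply: near_eq_cvg; apply: nearW => h.
rewrite scalerDr scalerA -mulrBr invfM invrK; set D := _ - _.
have ee : e^-1 * e = 1 by rewrite mulVf// gt_eqF.
move: (e^-1) (e ^- n) (h^-1) D ee => eV en hV D ee.
by rewrite -[RHS]mul1r -ee; ring.
Qed.

Lemma convolution1_rescale rho e x : mollifier rho -> 0 < e ->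
  convolution (fun=> 1) (rescale rho e) x = 1.
Proof.
move=> mrho e0; have [C kr] := mollifier_kernel mrho.
have [[mr _ _] [mre _ _]] := (kr, rescale_kernel e0 kr).
have [_ _ rho0 rho1] := mrho.
have mEr : measurable_fun setT (EFin \o rho) by exact/measurable_EFinP.
have rho_int : (\int[mu]_y (rho y)%:E = 1)%E.
  move: rho1; rewrite /Rintegral; case: (\int[mu]_y _)%E => [s /= ->//| |] /= /eqP;
    by rewrite eq_sym oner_eq0.
transitivity (fine (\int[mu]_y (rescale rho e y)%:E)%E).
  congr fine; under eq_integral do rewrite mul1r.
  apply: (ge0_integral_reflect x (F := EFin \o rescale rho e)) => [|y].
    exact/measurable_EFinP.
  by rewrite lee_fin mulr_ge0// invr_ge0 exprn_ge0// ltW.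
have mEre : measurable_fun setT (fun y => ((EFin \o rho) (0 + e^-1 *: y)%R)).
  by apply: (measurableT_comp mEr); exact: measurable_affine_rV.
have -> : (\int[mu]_y (rescale rho e y)%:E =
    (e ^- n)%:E * \int[mu]_y (EFin \o rho) (0 + e^-1 *: y)%R)%E.
  rewrite -ge0_integralZl//; first by apply: eq_integral => y _; rewrite /= add0r EFinM.
    by move=> y _; rewrite /= lee_fin.
  by rewrite lee_fin invr_ge0 exprn_ge0// ltW.
rewrite (ge0_integral_rV_affine 0 _ mEr); last 2 first.
- by rewrite invr_eq0 gt_eqF.
- by move=> y; rewrite lee_fin.
by rewrite rho_int mule1 /= gtr0_norm ?invr_gt0// invrK mulVf// expf_neq0// gt_eqF.
Qed.

(** The integral of w vanishes, as the derivative of the constant function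
obtained by convolving 1 with v. *)
Lemma convolution1_derive v w x d C C' e : 0 <= e -> kernel C e v -> kernel C' e w ->
  (forall z, is_derive z d v (w z)) -> (forall z, convolution (fun=> 1) v z = 1) ->
  convolution (fun=> 1) w x = 0.
Proof.
move=> e0 kv kw vw v1.
have [_ <-] := is_derive_convolution x e0 (locally_bounded_cst 1) kv kw vw.
rewrite (_ : convolution _ v = cst 1); last by apply/funext => z; rewrite v1.
exact: derive_cst.
Qed.

(** The factors e^-n and e^-n / e are the sizes of a rescaled mollifier and of its
derivative, so that C does not depend on e. *)
Definition approximate_identity d C e v w :=
  [/\ kernel (C * e ^- n) e v, kernel (C * e ^- n / e) e w,
      forall z, is_derive z d v (w z),
      forall x, convolution (fun=> 1) v x = 1 &
      forall x, convolution (fun=> 1) w x = 0].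

Lemma kernel_le C C' e v : C <= C' -> kernel C e v -> kernel C' e v.
Proof. by move=> CC' [mv vC ve]; split=> // x; exact: le_trans (vC x) CC'. Qed.

Lemma mollifier_approximate_identity rho j : mollifier rho ->
  exists2 C, 0 < C & forall e, 0 < e -> exists w,
    approximate_identity (delta_mx ord0 j) C e (rescale rho e) w.
Proof.
move=> mrho; have [C1 k1] := mollifier_kernel mrho.
have [C2 k2] := partial_mollifier_kernel j mrho.
exists (`|C1| + `|C2| + 1) => [|e e0]; first by rewrite ltr_wpDl.
pose w z := e^-1 * rescale (partial j rho) e z.
have en0 : 0 <= e ^- n by rewrite invr_ge0 exprn_ge0// ltW.
have e0' := ltW e0.
have kv : kernel ((`|C1| + `|C2| + 1) * e ^- n) e (rescale rho e).
  apply: kernel_le (rescale_kernel e0 k1); rewrite ler_wpM2r//.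
  by have := ler_norm C1; have := normr_ge0 C2; lra.
have kw : kernel ((`|C1| + `|C2| + 1) * e ^- n / e) e w.
  have [mw wC we] : kernel ((`|C1| + `|C2| + 1) * e ^- n) e (rescale (partial j rho) e).
    apply: kernel_le (rescale_kernel e0 k2); rewrite ler_wpM2r//.
    by have := ler_norm C2; have := normr_ge0 C1; lra.
  split; first exact: measurable_funM.
  - move=> z; rewrite normrM mulrC ler_pM// gtr0_norm ?invr_gt0//.
  - by move=> z; rewrite mulf_eq0 negb_or => /andP[_ /we].
have dv z : is_derive z (delta_mx ord0 j) (rescale rho e) (w z).
  apply: is_derive_rescale => // {}z; have [srho _ _ _] := mrho.
  by split=> //; have := (srho [::]).2 z j.
have v1 := fun x => convolution1_rescale x mrho e0.
exists w; split=> // x; exact: convolution1_derive kv kw dv v1.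
Qed.

End mollifier_kernels.

(** * Linearity of the convolution *)

Section convolution_linearity.
Context {R : realType} {n : nat}.
Local Notation mu := (@lebesgue_rV R n).
Implicit Types (u v w : 'rV[R]_n -> R) (x : 'rV[R]_n) (C e : R).
Variables (C e : R) (v : 'rV[R]_n -> R).
Hypotheses (e0 : 0 <= e) (kv : kernel C e v).

Lemma convolutionD u w x : locally_bounded u -> locally_bounded w ->
  convolution (fun y => u y + w y) v x = convolution u v x + convolution w v x.
Proof.
move=> bu bw; rewrite /convolution -RintegralD//; try exact: convolution_integrable kv.
by apply: eq_Rintegral => y _; rewrite mulrDl.
Qed.

Lemma convolutionZ c u x : locally_bounded u ->
  convolution (fun y => c * u y) v x = c * convolution u v x.
Proof.
move=> bu; rewrite /convolution -RintegralZl//; last exact: convolution_integrable kv.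
by apply: eq_Rintegral => y _; rewrite mulrA.
Qed.

Lemma locally_boundedD u w : locally_bounded u -> locally_bounded w ->
  locally_bounded (fun x => u x + w x).
Proof.
move=> [mu_ bu] [mw bw]; split=> [|r]; first exact: measurable_funD.
have [M uM] := bu r; have [N vN] := bw r; exists (M + N) => x xr.
by rewrite (le_trans (ler_normD _ _))// lerD// ?uM ?vN.
Qed.

Lemma locally_bounded_sum I (s : seq I) (u : I -> 'rV[R]_n -> R) :
  (forall k, locally_bounded (u k)) -> locally_bounded (fun y => \sum_(k <- s) u k y).
Proof.
move=> bu; elim: s => [|k s IH].
  by under eq_fun do rewrite big_nil; exact: locally_bounded_cst.
by under eq_fun do rewrite big_cons; exact: locally_boundedD.
Qed.

Lemma convolution_sum I (s : seq I) (u : I -> 'rV[R]_n -> R) x :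
  (forall k, locally_bounded (u k)) ->
  convolution (fun y => \sum_(k <- s) u k y) v x = \sum_(k <- s) convolution (u k) v x.
Proof.
move=> bu; elim: s => [|k s IH].
  rewrite big_nil; under [X in convolution X]eq_fun do rewrite big_nil -(mul0r 0).
  by rewrite convolutionZ ?mul0r//; exact: locally_bounded_cst.
rewrite big_cons -IH -convolutionD//; last exact: locally_bounded_sum.
by congr convolution; apply/funext => y; rewrite big_cons.
Qed.

Lemma convolutionBc u c x : locally_bounded u ->
  convolution (fun y => u y - c) v x =
  convolution u v x - c * convolution (fun=> 1) v x.
Proof.
move=> bu; rewrite convolutionD//; last exact: locally_bounded_cst.
rewrite -mulNr -convolutionZ; last exact: locally_bounded_cst.
by congr (_ + convolution _ _ _); apply/funext => y; rewrite mulr1.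
Qed.

Lemma mx_convolution_mulmx (g : 'rV[R]_n -> 'M[R]_n) (P Q : 'M[R]_n) i l x :
  (forall p q, locally_bounded (fun y => g y p q)) ->
  convolution (fun y => (P *m g y *m Q) i l) v x =
  (P *m mx_convolution g v x *m Q) i l.
Proof.
move=> bg.
have bPg p q c : locally_bounded (fun y => c * g y p q).
  by apply: locally_boundedM => //; exact: locally_bounded_cst.
have -> : (fun y => (P *m g y *m Q) i l) =
    fun y => \sum_q \sum_p (Q q l * P i p) * g y p q.
  apply/funext => y; rewrite mxE; apply: eq_bigr => q _.
  by rewrite mxE mulr_suml; apply: eq_bigr => p _; ring.
rewrite convolution_sum => [|q]; last exact: locally_bounded_sum.
rewrite mxE; apply: eq_bigr => q _.
rewrite convolution_sum// mxE mulr_suml; apply: eq_bigr => p _.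
by rewrite convolutionZ// !mxE; ring.
Qed.

End convolution_linearity.

(** * Size of convolutions with an approximate identity *)

Section convolution_estimates.
Context {R : realType} {n : nat}.
Local Notation mu := (@lebesgue_rV R n).
Implicit Types (u v w : 'rV[R]_n -> R) (x y d : 'rV[R]_n) (C e M : R).

(** Bounds a convolution by a mean over the cube of radius e. The comparison of u
with u' is required on that cube only, where the factor a_e(x) - a(y) is
small. *)
Lemma convolution_abs_le u u' v x C e B : 0 <= e -> 0 <= B -> locally_bounded u ->
  locally_bounded u' -> kernel C e v ->
  (forall y, `|x - y| <= e -> `|u y| <= B * `|u' y|) ->
  (`|convolution u v x|%:E <= (B * C)%:E *
   \int[mu]_z (\1_[set z : 'rV[R]_n | `|z| <= e] z * `|u' (x - z)|)%:E)%E.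
Proof.
move=> e0 B0 bu bu' kv uu'; have [mv vC ve] := kv.
have C0 : 0 <= C by exact: le_trans (normr_ge0 _) (vC 0).
pose Q := [set z : 'rV[R]_n | `|z| <= e].
pose F z := (\1_Q z * `|u' (x - z)|)%:E.
have mF : measurable_fun setT F.
  apply/measurable_EFinP; apply: measurable_funM.
    by apply: measurable_indic; exact: measurable_cube.
  by apply: measurableT_comp => //; apply: measurable_reflect; exact: bu'.1.
have F0 z : (0 <= F z)%E by rewrite lee_fin mulr_ge0.
have iuv := convolution_integrable x e0 bu kv.
have muv : measurable_fun setT (fun y => u y * v (x - y)).
  by apply: measurable_funM; [exact: bu.1|exact: measurable_reflect].
have BC0 : (0 <= (B * C)%:E)%E by rewrite lee_fin mulr_ge0.
have mFx : measurable_fun setT (fun y => F (x - y)).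
  apply: (measurableT_comp mF); under eq_fun do rewrite -scaleN1r.
  exact: measurable_affine_rV.
rewrite -(ge0_integral_reflect x mF F0) -(ge0_integralZl _ _ mFx _ BC0)//.
apply: (@le_trans _ _ (\int[mu]_y `|u y * v (x - y)|%:E)%E).
  rewrite EFin_normr_Rintegral//.
  by apply: le_abse_integral => //; exact/measurable_EFinP.
apply: ge0_le_integral => //.
- by apply/measurable_EFinP; exact: measurableT_comp.
- exact: measurable_funeM.
move=> y _; rewrite /F subKr -EFinM lee_fin normrM.
have [->|vy] := eqVneq (v (x - y)) 0.
  by rewrite normr0 mulr0 !mulr_ge0.
have xye := ve _ vy.
rewrite indicE mem_set// mul1r -mulrA [C * _]mulrC mulrA ler_pM//.
exact: uu'.
Qed.

(** Subtracting the constant u x changes the first convolution by u x and leaves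
the second one unchanged, since v has integral 1 and w has integral 0. The
powers of e in the volume of the cube and in the size of v cancel. *)
Lemma approximate_identity_bound d u v w x C e M : 0 < e -> locally_bounded u ->
  approximate_identity d C e v w ->
  (forall y, `|x - y| <= e -> `|u y - u x| <= M) ->
  `|convolution u v x - u x| <= M * C * 2 ^+ n /\
  `|convolution u w x| <= M * C * 2 ^+ n / e.
Proof.
move=> e0 bu [kv kw _ v1 w1] uM; have e0' := ltW e0.
have bu' : locally_bounded (fun y => u y - u x).
  by apply: locally_boundedD => //; exact: locally_bounded_cst.
have e1 : e ^- n * e ^+ n = 1 by rewrite mulVf// expf_neq0// gt_eqF.
have [_ Hv] := convolution_bound e0' bu' kv uM; have [_ Hw] := convolution_bound e0' bu' kw uM.
move: Hv Hw; rewrite (convolutionBc e0' kv _ _ bu) (convolutionBc e0' kw _ _ bu).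
rewrite v1 w1 mulr1 mulr0 subr0 exprMn.
have -> : M * (C * e ^- n) * (2 ^+ n * e ^+ n) = M * C * 2 ^+ n.
  by rewrite -[RHS]mulr1 -e1; ring.
have -> : M * (C * e ^- n / e) * (2 ^+ n * e ^+ n) = M * C * 2 ^+ n / e.
  by rewrite -[RHS]mulr1 -e1; ring.
by [].
Qed.

End convolution_estimates.

(** * Pointwise estimates of the commutator *)

(** The point x is fixed in this section: the hypotheses on g are those provided
by [metric_bounds] at x, and the last three say how small e has to be. *)
Section commutator.
Context {R : realType} {n : nat}.
Local Notation mu := (@lebesgue_rV R n).
Variables (g : 'rV[R]_n -> 'M[R]_n) (i l : 'I_n).
Hypotheses (lg : locally_lipschitz g) (ug : forall x, g x \in unitmx).
Variables (L d0 C e : R) (dir : 'rV[R]_n) (v w : 'rV[R]_n -> R) (x : 'rV[R]_n).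
Hypotheses (L0 : 0 < L) (C0 : 0 < C) (e0 : 0 < e).
Hypothesis vw : approximate_identity dir C e v w.
Hypothesis g_lip : forall y, `|x - y| < d0 -> `|g x - g y| <= L * `|x - y|.
Hypothesis g_inv : forall H, `|H - g x| < d0 -> H \in unitmx /\ `|invmx H| <= L.
(* c bounds the derivative of the mollified metric, and c * e its distance to g. *)
Let c := L * C * 2 ^+ n.
Hypotheses (ed : e < d0) (Led : L * e < d0) (ced : c * e < d0).

Let a := inverse_component g i l.
Let a_ := inverse_component (mx_convolution g v) i l.
Let N : R := n%:R ^+ 2.
Let Gx := mx_convolution g v x.
Let G'x := mx_convolution g w x.
Let a_' := - (invmx Gx *m G'x *m invmx Gx) i l.

Lemma locally_bounded_entry p q : locally_bounded (fun y => g y p q).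
Proof.
apply: continuous_locally_bounded => y.
have := locally_lipschitz_continuous lg (x := y) => /cvgrPdist_lt gy.
apply/(@cvgrPdist_lt _ _ _ (nbhs y) _) => s s0.
apply: filterS (gy _ s0) => z; apply: le_lt_trans.
by have := le_mx_norm (g y - g z) p q; rewrite !mxE.
Qed.

Lemma metric_near y : `|x - y| <= e -> `|g x - g y| <= L * e.
Proof.
move=> xye; rewrite (le_trans (g_lip _)) ?ler_pM2l//.
exact: le_lt_trans ed.
Qed.

Lemma invmx_metric_bound y : `|x - y| <= e -> `|invmx (g y)| <= L.
Proof.
move=> xye; have [|] := @g_inv (g y) => //.
by rewrite distrC (le_lt_trans (metric_near xye)).
Qed.

Lemma mollified_metric_near : `|Gx - g x| <= c * e.
Proof.
apply/mx_norm_leP => [|p q]; first by rewrite !mulr_ge0 ?exprn_ge0 ?ltW.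
rewrite !mxE.
have [] := @approximate_identity_bound _ _ _ _ _ _ x _ _ (L * e) e0 (locally_bounded_entry p q) vw.
  move=> y xye; rewrite distrC (le_trans _ (metric_near xye))//.
  by have := le_mx_norm (g x - g y) p q; rewrite !mxE.
by move=> + _ => /le_trans; apply; rewrite /c le_eqVlt; apply/orP; left; apply/eqP; ring.
Qed.

(** The Lipschitz bound L * e for the oscillation of g compensates the factor
1 / e in the size of w. *)
Lemma mollified_metric_deriv_bound : `|G'x| <= c.
Proof.
apply/mx_norm_leP => [|p q]; first by rewrite !mulr_ge0 ?exprn_ge0 ?ltW.
rewrite !mxE.
have [] := @approximate_identity_bound _ _ _ _ _ _ x _ _ (L * e) e0 (locally_bounded_entry p q) vw.
  move=> y xye; rewrite distrC (le_trans _ (metric_near xye))//.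
  by have := le_mx_norm (g x - g y) p q; rewrite !mxE.
move=> _ /le_trans; apply; rewrite /c le_eqVlt; apply/orP; left; apply/eqP.
by field; rewrite gt_eqF.
Qed.

Lemma mollified_metric_unit : Gx \in unitmx /\ `|invmx Gx| <= L.
Proof. by apply: g_inv; exact: le_lt_trans mollified_metric_near _. Qed.

Lemma invmx_metric_bound_center : `|invmx (g x)| <= L.
Proof. by apply: invmx_metric_bound; rewrite subrr normr0 ltW. Qed.

Lemma is_derive_mollified_inverse : is_derive x dir a_ a_'.
Proof.
have [kv kw dv _ _] := vw.
apply: is_derive_invmx_entry => [|p q]; first exact: mollified_metric_unit.1.
have -> : (fun y => mx_convolution g v y p q) = convolution (fun y => g y p q) v.
  by apply/funext => y; rewrite mxE.
rewrite /G'x mxE.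
exact: is_derive_convolution (ltW e0) (locally_bounded_entry p q) kv kw dv.
Qed.

Lemma mx_norm_mulmx3 (A B D : 'M[R]_n) al be de : `|A| <= al -> `|B| <= be -> `|D| <= de ->
  `|A *m B *m D| <= N * (al * be * de).
Proof.
move=> Aa Bb Dd; rewrite (le_trans (mx_norm_mulmx _ _))// /N expr2 -!mulrA ler_wpM2l//.
rewrite mulrA; apply: (@le_trans _ _ (n%:R * (`|A| * `|B|) * `|D|)).
  by rewrite ler_wpM2r// mx_norm_mulmx.
by rewrite -!mulrA ler_wpM2l// !mulrA !ler_pM// mulr_ge0.
Qed.

Lemma mollified_inverse_deriv_bound : `|a_'| <= N * (L * c * L).
Proof.
rewrite normrN (le_trans (le_mx_norm _ _ _))// mx_norm_mulmx3 ?mollified_metric_deriv_bound//;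
  exact: mollified_metric_unit.2.
Qed.

Lemma mollified_invmx_near y : `|x - y| <= e ->
  `|invmx Gx - invmx (g y)| <= N * (L * ((c + L) * e) * L).
Proof.
move=> xye; rewrite invmx_sub ?mollified_metric_unit.1// mx_norm_mulmx3 ?mollified_metric_unit.2 ?invmx_metric_bound//.
have := ler_distD (g x) (g y) Gx; have := mollified_metric_near; have := metric_near xye.
rewrite ![`|_ - Gx|]distrC ![`|g y - _|]distrC; lra.
Qed.

Lemma mollified_inverse_near y : `|x - y| <= e -> `|a_ x - a y| <= N * (L * ((c + L) * e) * L).
Proof.
move=> /mollified_invmx_near; apply: le_trans.
by have := le_mx_norm (invmx Gx - invmx (g y)) i l; rewrite !mxE.
Qed.

(* C3 * e bounds a_ x - a y for |x - y| <= e, and C2 * e the commutator on the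
   constant function 1. *)
Let C3 := N * (L * (c + L) * L).
Let C2 := 2 * N * (C3 * c * L) + N * (N * (L * L * L) * L * L) * C * 2 ^+ n.

Lemma c_ge0 : 0 <= c. Proof. by rewrite !mulr_ge0 ?exprn_ge0 ?ltW. Qed.

Lemma N_ge0 : 0 <= N. Proof. by rewrite exprn_ge0. Qed.

Lemma C3_ge0 : 0 <= C3.
Proof. by rewrite mulr_ge0 ?N_ge0// !mulr_ge0 ?addr_ge0 ?c_ge0// ltW. Qed.

Lemma locally_bounded_inverse : locally_bounded a.
Proof.
apply: continuous_locally_bounded => y.
have gy : `|g t - g y| @[t --> y] --> 0.
  apply/(@cvgrPdist_lt _ _ _ (nbhs y) _) => s s0.
  have /(@cvgrPdist_lt _ _ _ (nbhs y) _)/(_ _ s0) := locally_lipschitz_continuous lg (x := y).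
  by apply: filterS => t; rewrite sub0r normrN normr_id distrC.
have [_ /(@cvgrPdist_lt _ _ _ (nbhs y) _) ig] := cvg_invmx (ug y) gy.
apply/(@cvgrPdist_lt _ _ _ (nbhs y) _) => s s0.
apply: filterS (ig _ s0) => z; rewrite sub0r normrN normr_id; apply: le_lt_trans.
by have := le_mx_norm (invmx (g z) - invmx (g y)) i l; rewrite !mxE distrC.
Qed.

Let P := invmx (g x).

(** To first order, the variation of the inverse metric is that of the metric
conjugated by P; the error is quadratic in the variation of g, because
P - invmx (g y) is again of order e. *)
Lemma inverse_linearization y : `|x - y| <= e ->
  `|a y - a x + (P *m (g y - g x) *m P) i l| <= N * (N * (L * (L * e) * L) * (L * e) * L).
Proof.
move=> xye; have gxy := metric_near xye; have gyx : `|g y - g x| <= L * e by rewrite distrC.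
have -> : a y - a x + (P *m (g y - g x) *m P) i l =
    ((P - invmx (g y)) *m (g y - g x) *m P) i l.
  have := invmx_sub (ug y) (ug x) => /matrixP/(_ i l).
  rewrite [in X in X -> _]mxE [in X in X -> _]mxE => aE.
  have -> : a y - a x = (invmx (g y) *m (g x - g y) *m P) i l by rewrite -aE.
  by rewrite mulmxBl mulmxBl -[g x - g y]opprB mulmxN mulNmx !mxE addrC.
rewrite (le_trans (le_mx_norm _ _ _))// mx_norm_mulmx3 ?invmx_metric_bound_center//.
by rewrite invmx_sub// mx_norm_mulmx3 ?invmx_metric_bound_center ?invmx_metric_bound.
Qed.

(** The derivative of the mollified inverse metric, up to O(e): the quadratic
error of [inverse_linearization] loses one power of e by convolution with w. *)
Lemma convolution_inverse_linearized : `|convolution a w x + (P *m G'x *m P) i l| <=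
  N * (N * (L * L * L) * L * L) * C * 2 ^+ n * e.
Proof.
have [kv kw dv v1 w1] := vw.
pose E y := (a y + (P *m g y *m P) i l) - (a x + (P *m g x *m P) i l).
have bPgP : locally_bounded (fun y => (P *m g y *m P) i l).
  have -> : (fun y => (P *m g y *m P) i l) =
      fun y => \sum_q \sum_p (P q l * P i p) * g y p q.
    apply/funext => y; rewrite mxE; apply: eq_bigr => q _.
    by rewrite mxE mulr_suml; apply: eq_bigr => p _; ring.
  apply: locally_bounded_sum => q; apply: locally_bounded_sum => p.
  by apply: locally_boundedM; [exact: locally_bounded_cst|exact: locally_bounded_entry].
have bS := locally_boundedD locally_bounded_inverse bPgP.
have bE : locally_bounded E.
  by apply: locally_boundedD => //; exact: locally_bounded_cst.
have Ex : E x = 0 by rewrite /E subrr.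
have -> : convolution a w x + (P *m G'x *m P) i l = convolution E w x.
  rewrite (convolutionBc (ltW e0) kw)// w1 mulr0 subr0 (convolutionD (ltW e0) kw)//.
    by rewrite (mx_convolution_mulmx (ltW e0) kw)// => p q; exact: locally_bounded_entry.
  exact: locally_bounded_inverse.
have [|_] := @approximate_identity_bound _ _ _ _ _ _ x _ _
    (N * (N * (L * (L * e) * L) * (L * e) * L)) e0 bE vw.
  move=> y /inverse_linearization; apply: le_trans; rewrite Ex subr0 /E.
  rewrite mulmxBr mulmxBl !mxE le_eqVlt; apply/orP; left; apply/eqP; congr `|_|; ring.
move=> /le_trans; apply; rewrite le_eqVlt; apply/orP; left; apply/eqP.
by field; rewrite gt_eqF.
Qed.

(** The commutator on constant functions. The derivative of the inverse of the
mollified metric and the derivative of the mollified inverse metric agree up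
to O(e), since both are close to minus P *m G'x *m P. *)
Lemma commutator_cst_bound : `|a_' - convolution a w x| <= C2 * e.
Proof.
have conv_small := convolution_inverse_linearized.
have dI : `|invmx Gx - P| <= C3 * e.
  have := @mollified_invmx_near x; rewrite subrr normr0 => /(_ (ltW e0))/le_trans; apply.
  by rewrite /C3 le_eqVlt; apply/orP; left; apply/eqP; ring.
have dQ : `|(invmx Gx *m G'x *m invmx Gx) i l - (P *m G'x *m P) i l| <=
    2 * N * (C3 * c * L) * e.
  have -> : (invmx Gx *m G'x *m invmx Gx) i l - (P *m G'x *m P) i l =
      ((invmx Gx - P) *m G'x *m invmx Gx) i l + (P *m G'x *m (invmx Gx - P)) i l.
    by rewrite !mulmxBl mulmxBr !mxE; ring.
  have h1 : `|(invmx Gx - P) *m G'x *m invmx Gx| <= N * (C3 * e * c * L).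
    by rewrite mx_norm_mulmx3 ?mollified_metric_deriv_bound// mollified_metric_unit.2.
  have h2 : `|P *m G'x *m (invmx Gx - P)| <= N * (L * c * (C3 * e)).
    by rewrite mx_norm_mulmx3 ?mollified_metric_deriv_bound ?invmx_metric_bound_center.
  rewrite (le_trans (ler_normD _ _))//.
  apply: (le_trans (lerD (le_trans (le_mx_norm _ _ _) h1) (le_trans (le_mx_norm _ _ _) h2))).
  by rewrite le_eqVlt; apply/orP; left; apply/eqP; ring.
rewrite /a_' /C2 mulrDl.
have -> : - (invmx Gx *m G'x *m invmx Gx) i l - convolution a w x =
   - ((invmx Gx *m G'x *m invmx Gx) i l - (P *m G'x *m P) i l) -
   (convolution a w x + (P *m G'x *m P) i l) by ring.
by rewrite (le_trans (ler_normB _ _))// normrN lerD.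
Qed.

Section test_function.
Variable f : 'rV[R]_n -> R.
Hypothesis bf : locally_bounded f.

(** All derivatives fall on the kernel, so that f need only be locally bounded. *)
Definition commutator_deriv := a_' * convolution f v x + a_ x * convolution f w x
  - convolution (fun y => a y * f y) w x.

Let T := commutator_deriv.

Lemma is_derive_commutator :
  is_derive x dir (fun y => a_ y * convolution f v y
    - convolution (fun y => a y * f y) v y) T.
Proof.
have [kv kw dv _ _] := vw.
have da := is_derive_mollified_inverse.
have df := is_derive_convolution x (ltW e0) bf kv kw dv.
have daf := is_derive_convolution x (ltW e0) (locally_boundedM locally_bounded_inverse bf) kv kw dv.
have [exH vH] := is_deriveB (is_deriveM da df) daf.
split; [exact: exH|apply: etrans vH _].
by rewrite /T /commutator_deriv /GRing.scale /=; ring.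
Qed.

(* K * e ^- n bounds the kernel of the commutator. *)
Let K := (N * (L * c * L) + C3) * C.

Let gap y := a_ x - a y.

Lemma locally_bounded_gap : locally_bounded gap.
Proof.
have -> : gap = fun y => a_ x + -1 * a y by apply/funext => y; rewrite /gap; ring.
apply: locally_boundedD; first exact: locally_bounded_cst.
by apply: locally_boundedM; [exact: locally_bounded_cst|exact: locally_bounded_inverse].
Qed.

Lemma convolution_gap u : locally_bounded u -> convolution (fun y => gap y * u y) w x =
  a_ x * convolution u w x - convolution (fun y => a y * u y) w x.
Proof.
move=> bu; have [kv kw dv _ _] := vw; have e0' := ltW e0.
have bau := locally_boundedM locally_bounded_inverse bu.
have -> : (fun y => gap y * u y) = fun y => a_ x * u y + -1 * (a y * u y).
  by apply/funext => y; rewrite /gap; ring.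
rewrite (convolutionD e0' kw) ?(convolutionZ e0' kw)//; first by rewrite mulN1r.
- by apply: locally_boundedM => //; exact: locally_bounded_cst.
- by apply: locally_boundedM => //; exact: locally_bounded_cst.
Qed.

Lemma gap_bound y : `|x - y| <= e -> `|gap y| <= C3 * e.
Proof.
move=> /mollified_inverse_near/le_trans; apply.
by rewrite /C3 le_eqVlt; apply/orP; left; apply/eqP; ring.
Qed.

(** The gap is O(e) on the support of w, which makes its product with w
comparable to v. *)
Lemma commutator_bounded (M : R) : (forall y, `|f y| <= M) -> `|T| <= K * 2 ^+ n * M.
Proof.
move=> fM; have [kv kw _ _ _] := vw; have e0' := ltW e0.
have e1 : e ^- n * e ^+ n = 1 by rewrite mulVf// expf_neq0// gt_eqF.
have M0 : 0 <= M by exact: le_trans (normr_ge0 _) (fM 0).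
rewrite /T /commutator_deriv -addrA -convolution_gap//.
have [_ h1] := convolution_bound (x := x) (M := M) e0' bf kv (fun y _ => fM y).
have h2 : `|convolution (fun y => gap y * f y) w x| <=
    C3 * e * M * (C * e ^- n / e) * (2 * e) ^+ n.
  apply: (convolution_bound e0' (locally_boundedM locally_bounded_gap bf) kw _).2 => y xye.
  by rewrite normrM ler_pM// gap_bound.
rewrite (le_trans (ler_normD _ _))// normrM.
apply: (le_trans (lerD (ler_pM (normr_ge0 _) (normr_ge0 _) mollified_inverse_deriv_bound h1) h2)).
rewrite le_eqVlt; apply/orP; left; apply/eqP.
transitivity (K * 2 ^+ n * M * (e ^- n * e ^+ n)); last by rewrite e1 mulr1.
rewrite /K !exprMn; move: (e ^- n) => en; field; by rewrite gt_eqF.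
Qed.

(** Splits f into the constant f x, on which the commutator is O(e), and f - f x,
on which the kernel bound gives a mean over the cube of radius e. *)
Lemma commutator_oscillation : (`|T|%:E <= (`|f x| * (C2 * e))%:E +
  (K * e ^- n)%:E * \int[mu]_z
    (\1_[set z : 'rV[R]_n | `|z| <= e] z * `|f (x - z) - f x|)%:E)%E.
Proof.
have [kv kw _ v1 w1] := vw; have e0' := ltW e0.
pose F y := f y - f x.
have bF : locally_bounded F.
  by apply: locally_boundedD => //; exact: locally_bounded_cst.
have -> : T = f x * (a_' - convolution a w x) + (a_' * convolution F v x +
    convolution (fun y => gap y * F y) w x).
  rewrite convolution_gap// (convolutionBc e0' kv)// (convolutionBc e0' kw)// v1 w1.
  have -> : convolution (fun y => a y * F y) w x =
      convolution (fun y => a y * f y) w x - f x * convolution a w x.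
    have -> : (fun y => a y * F y) = fun y => a y * f y + (- f x) * a y.
      by apply/funext => y; rewrite /F; ring.
    have bA := locally_bounded_inverse; have bAf := locally_boundedM bA bf.
    have bcA : locally_bounded (fun y => - f x * a y).
      by apply: locally_boundedM => //; exact: locally_bounded_cst.
    by rewrite (convolutionD e0' kw _ bAf bcA) (convolutionZ e0' kw _ _ bA) mulNr.
  by rewrite /T /commutator_deriv; ring.
set D := (\int[mu]_z _)%E.
have D0 : (0 <= D)%E by apply: integral_ge0 => z _; rewrite lee_fin mulr_ge0.
have h1 : (`|convolution F v x|%:E <= (1 * (C * e ^- n))%:E * D)%E.
  by apply: (@convolution_abs_le _ _ F F v x) => // y _; rewrite mul1r.
have h2 : (`|convolution (fun y => (gap y * F y)%R) w x|%:E <= (C3 * e * (C * e ^- n / e))%:E * D)%E.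
  apply: (@convolution_abs_le _ _ (fun y => gap y * F y) F w x) => //; first by rewrite mulr_ge0 ?C3_ge0.
    exact: locally_boundedM locally_bounded_gap bF.
  by move=> y xye; rewrite normrM ler_wpM2r// gap_bound.
apply: (@le_trans _ _ (`|f x * (a_' - convolution a w x)|%:E +
   (`|a_'|%:E * `|convolution F v x|%:E + `|convolution (fun y => (gap y * F y)%R) w x|%:E))%E).
  rewrite -EFinM -!EFinD lee_fin -normrM.
  by rewrite (le_trans (ler_normD _ _))// lerD// ler_normD.
apply: leeD.
  by rewrite lee_fin normrM ler_wpM2l// commutator_cst_bound.
have -> : ((K * e ^- n)%:E * D = (N * (L * c * L))%:E * ((1 * (C * e ^- n))%:E * D) +
    (C3 * e * (C * e ^- n / e))%:E * D)%E.
  have en0 : 0 <= e ^- n by rewrite invr_ge0 exprn_ge0.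
  rewrite muleA -EFinM -ge0_muleDl; first last.
  - apply: mulr_ge0; first exact: mulr_ge0 C3_ge0 e0'.
    by rewrite mulr_ge0 ?invr_ge0// mulr_ge0// ltW.
  - apply: mulr_ge0; last by rewrite mul1r mulr_ge0// ltW.
    exact: mulr_ge0 N_ge0 (mulr_ge0 (mulr_ge0 (ltW L0) c_ge0) (ltW L0)).
  rewrite -EFinD; congr (_%:E * _)%E; rewrite /K.
  by move: (e ^- n) => en; field; rewrite gt_eqF.
apply: leeD => //; apply: lee_pmul => //.
by rewrite lee_fin mollified_inverse_deriv_bound.
Qed.

End test_function.
End commutator.

(** * Mean oscillation of bounded functions *)

(** Monotonicity without measurability: the integral of a nonnegative function is
a supremum over the simple functions below it. It spares the measurability of
the derivative of the commutator. *)
Lemma le_integral_nonneg d (T : measurableType d) (R : realType)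
    (mu : {measure set T -> \bar R}) (f1 f2 : T -> \bar R) :
  (forall x, 0 <= f1 x <= f2 x)%E -> (\int[mu]_x f1 x <= \int[mu]_x f2 x)%E.
Proof.
move=> f12; rewrite !ge0_integralTE//; first last.
- by move=> x; have /andP[] := f12 x.
- by move=> x; have /andP[] := f12 x; exact: le_trans.
apply: le_ereal_sup => _ [h hf1 <-]; exists h => // x.
by have /andP[_] := f12 x; exact: le_trans.
Qed.

Section oscillation.
Context {R : realType} {n : nat}.
Local Notation mu := (@lebesgue_rV R n).
Local Notation cube r := [set x : 'rV[R]_n | `|x| <= r].
Implicit Types (f : 'rV[R]_n -> R).

Lemma measurable_rV_sub : measurable_fun setT (fun p : 'rV[R]_n * 'rV[R]_n => p.1 - p.2).
Proof.
apply: measurable_fun_rV => k; under eq_fun do rewrite !mxE.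
by apply: measurable_funB; apply: (measurableT_comp (measurable_coord k)).
Qed.

Lemma measurable_oscillation f e : measurable_fun setT f -> measurable_fun setT
  (fun x : 'rV[R]_n => \int[mu]_z (\1_(cube e) z * `|f (x - z) - f x|)%:E)%E.
Proof.
move=> mf; pose F (p : 'rV[R]_n * 'rV[R]_n) : \bar R :=
  (\1_(cube e) p.2 * `|f (p.1 - p.2) - f p.1|)%:E.
apply: (measurable_fun_fubini_tonelli_F F) => [|p]; last by rewrite lee_fin mulr_ge0.
apply/measurable_EFinP; apply: measurable_funM.
  have m1 : measurable_fun setT (\1_(cube e) : 'rV[R]_n -> R).
    by apply: measurable_indic; exact: measurable_cube.
  exact: (measurableT_comp m1).
apply: measurableT_comp => //; apply: measurable_funB.
  exact: (measurableT_comp mf measurable_rV_sub).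
exact: (measurableT_comp mf).
Qed.

(** Tonelli's theorem and the invariance under translations: each of the two
copies of psi contributes its integral times the volume of the cube of
radius e. *)
Lemma oscillation_le f (psi : 'rV[R]_n -> R) r e c : measurable_fun setT psi ->
  0 <= r -> 0 <= e -> 0 <= c -> (forall x, 0 <= psi x) ->
  (forall x z, `|x| <= r -> `|z| <= e -> `|f (x - z) - f x| <= psi (x - z) + psi x + c) ->
  (\int[mu]_(x in cube r) \int[mu]_z (\1_(cube e) z * `|f (x - z) - f x|)%:E <=
   ((2 * e) ^+ n)%:E * (2%:E * \int[mu]_x (psi x)%:E + (c * (2 * r) ^+ n)%:E))%E.
Proof.
move=> mpsi r0 e0 c0 psi0 osc.
have mQ s : measurable (cube s) by exact: measurable_cube.
have m1 s : measurable_fun setT (\1_(cube s) : 'rV[R]_n -> R) by exact: measurable_indic.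
pose F (p : 'rV[R]_n * 'rV[R]_n) : \bar R :=
  (\1_(cube e) p.2 * (psi (p.1 - p.2) + psi p.1 + c * \1_(cube r) p.1))%:E.
have mF : measurable_fun setT F.
  apply/measurable_EFinP; apply: measurable_funM.
    exact: (measurableT_comp (m1 e)).
  apply: measurable_funD; last first.
    by apply: measurable_funM => //; exact: (measurableT_comp (m1 r)).
  apply: measurable_funD; last exact: (measurableT_comp mpsi).
  exact: (measurableT_comp mpsi measurable_rV_sub).
have F0 p : (0 <= F p)%E by rewrite lee_fin mulr_ge0// !addr_ge0// mulr_ge0.
apply: (@le_trans _ _ (\int[mu]_x \int[mu]_z F (x, z))%E).
  rewrite integral_mkcond; apply: le_integral_nonneg => x.
  rewrite patchE; case: ifPn => [xr|_]; last by rewrite lexx integral_ge0.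
  rewrite integral_ge0/=; last by move=> z _; rewrite lee_fin mulr_ge0.
  apply: le_integral_nonneg => z; rewrite !lee_fin mulr_ge0//=.
  have [ze|ze] := pselect (cube e z); last by rewrite indicE memNset// !mul0r.
  rewrite [\1__ z]indicE mem_set// !mul1r indicE xr mulr1; apply: osc => //.
  by move: xr; rewrite inE.
rewrite (fubini_tonelli F)//.
have E z : (\int[mu]_x F (x, z) = (\1_(cube e) z)%:E *
    (2%:E * \int[mu]_x (psi x)%:E + (c * (2 * r) ^+ n)%:E))%E.
  rewrite /F /=.
  under eq_integral do rewrite EFinM EFinD EFinD.
  have mEpsi : measurable_fun setT (EFin \o psi) by exact/measurable_EFinP.
  have pz : (fun x : 'rV[R]_n => (psi (x - z))%:E) = fun x => (EFin \o psi) (- z + 1 *: x).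
    by apply/funext => x; rewrite /= scale1r addrC.
  have mpz : measurable_fun setT (fun x : 'rV[R]_n => (psi (x - z))%:E).
    by rewrite pz; apply: (measurableT_comp mEpsi); exact: measurable_affine_rV.
  have mEc : measurable_fun setT (fun x => (c * \1_(cube r) x)%:E).
    by apply/measurable_EFinP; exact: measurable_funM.
  rewrite ge0_integralZl//; last 2 first.
  - by apply: emeasurable_funD => //; exact: emeasurable_funD.
  - by move=> x _; rewrite -!EFinD lee_fin !addr_ge0// mulr_ge0.
  congr (_ * _)%E.
  rewrite ge0_integralD//; last 3 first.
  - by move=> x _; rewrite -EFinD lee_fin addr_ge0.
  - exact: emeasurable_funD.
  - by move=> x _; rewrite lee_fin mulr_ge0.
  rewrite ge0_integralD//; try by move=> x _; rewrite lee_fin.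
  have -> : (\int[mu]_x (psi (x - z)%R)%:E = \int[mu]_x (psi x)%:E)%E.
    under eq_integral do rewrite (congr1 (@^~ _) pz).
    rewrite (ge0_integral_rV_affine (- z) _ mEpsi) ?oner_neq0//.
    by rewrite normr1 invr1 expr1n mul1e.
  have -> : (\int[mu]_x (c * \1_(cube r) x)%:E = (c * (2 * r) ^+ n)%:E)%E.
    under eq_integral do rewrite EFinM.
    rewrite ge0_integralZl//; last exact/measurable_EFinP.
    by rewrite cube_integral_indic.
  congr (_ + _)%E; rewrite (_ : 2%:E = 1 + 1)%E; last by rewrite -EFinD.
  by rewrite ge0_muleDl ?mul1e.
under eq_integral do rewrite E.
have I0 : (0 <= \int[mu]_x (psi x)%:E)%E by apply: integral_ge0 => x _; rewrite lee_fin.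
have k0 : (0 <= 2%:E * \int[mu]_x (psi x)%:E + (c * (2 * r) ^+ n)%:E)%E.
  by rewrite adde_ge0 ?mule_ge0// lee_fin mulr_ge0// exprn_ge0// mulr_ge0.
rewrite ge0_integralZr//; last exact/measurable_EFinP.
by rewrite cube_integral_indic.
Qed.

(** Here psi is the distance of f to a Lipschitz function phi on a slightly larger
cube, and the remaining term c is the oscillation of phi, at most L * e. *)
Lemma oscillation_cvg0 f r M d : measurable_fun setT f -> (forall x, `|f x| <= M) ->
  0 <= r -> 0 < d ->
  \forall e \near 0^'+, ((e ^- n)%:E * \int[mu]_(x in cube r)
    \int[mu]_z (\1_(cube e) z * `|f (x - z) - f x|)%:E <= d%:E)%E.
Proof.
move=> mf fM r0 d0.
(* The volume (2 * e) ^+ n leaves the factor 2 ^+ n; each copy of psi takes a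
   quarter of d, and the oscillation of phi takes a half. *)
pose d1 := d / 2 ^+ n / 4.
have d10 : 0 < d1 by rewrite !divr_gt0 ?exprn_gt0.
have [phi [L Lphi] fphi] := (L1_approximable_bounded (r + 1) mf fM).2 _ d10.
have mphi : measurable_fun setT phi by apply: is_lipschitz_measurable; exists L.
pose psi x := \1_(cube (r + 1)) x * `|f x - phi x|.
have mcube : measurable (cube (r + 1)) by exact: measurable_cube.
have mpsi : measurable_fun setT psi.
  apply: measurable_funM; first exact: measurable_indic.
  by apply: measurableT_comp => //; exact: measurable_funB.
have psi0 x : 0 <= psi x by rewrite mulr_ge0.
have psi_int : (\int[mu]_x (psi x)%:E <= d1%:E)%E.
  apply: le_trans fphi; rewrite [leRHS]integral_mkcond.
  rewrite le_eqVlt; apply/orP; left; apply/eqP; apply: eq_integral => x _.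
  by rewrite patchE /psi indicE; case: ifP => _; rewrite ?mul1r ?mul0r.
have lt0 := mulr_ge0 (normr_ge0 L) (exprn_ge0 n (mulr_ge0 (ler0n R 2) r0)).
have k0 : 0 < `|L| * (2 * r) ^+ n + 1 by rewrite ltr_wpDl.
near=> e.
have e0 : 0 < e by [].
have e1 : e <= 1 by near: e; exact: nbhs_right_le.
have en0 : 0 <= e ^- n by rewrite invr_ge0 exprn_ge0// ltW.
have c0 : 0 <= `|L| * e by rewrite mulr_ge0// ltW.
have small : `|L| * e * (2 * r) ^+ n <= d1 * 2.
  have : e <= d1 / (`|L| * (2 * r) ^+ n + 1) by near: e; apply: nbhs_right_le; rewrite divr_gt0//.
  rewrite ler_pdivlMr// mulrAC; move: (`|L| * _ ^+ n) lt0 => t lt0.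
  by have := ltW e0; nra.
have osc x z : `|x| <= r -> `|z| <= e ->
    `|f (x - z) - f x| <= psi (x - z) + psi x + `|L| * e.
  move=> xr ze.
  have xB : \1_(cube (r + 1)) x = 1 :> R.
    by rewrite indicE mem_set//= (le_trans xr)// lerDl.
  have xzB : \1_(cube (r + 1)) (x - z) = 1 :> R.
    by rewrite indicE mem_set//= (le_trans (ler_normB _ _))// lerD// (le_trans ze).
  rewrite /psi xB xzB !mul1r.
  have h : `|phi (x - z) - phi x| <= `|L| * e.
    rewrite (le_trans (Lphi _ _))// addrAC subrr add0r normrN.
    by rewrite (le_trans (ler_wpM2r _ (ler_norm L)))// ler_wpM2l.
  have := ler_distD (phi (x - z)) (f (x - z)) (f x).
  have := ler_distD (phi x) (phi (x - z)) (f x).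
  rewrite [`|phi x - f x|]distrC; lra.
apply: (le_trans (lee_wpmul2l _ (oscillation_le mpsi r0 (ltW e0) c0 psi0 osc))).
  by rewrite lee_fin.
apply: (@le_trans _ _ ((e ^- n)%:E * ((2 * e) ^+ n)%:E * (2%:E * d1%:E + (d1 * 2)%:E))%E).
  rewrite -muleA lee_wpmul2l ?lee_fin// lee_wpmul2l ?lee_fin ?exprn_ge0 ?mulr_ge0 ?(ltW e0)//.
  by rewrite leeD ?lee_fin// lee_wpmul2l ?lee_fin.
rewrite -!EFinM lee_fin exprMn /d1.
have ee : e ^- n * e ^+ n = 1 by rewrite mulVf// expf_neq0// gt_eqF.
have t0 : 2 ^+ n != 0 :> R by rewrite expf_neq0.
rewrite le_eqVlt; apply/orP; left; apply/eqP.
transitivity (d * (e ^- n * e ^+ n)); last by rewrite ee mulr1.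
by move: (e ^- n) => en; field.
Unshelve. all: by end_near. Qed.

End oscillation.

(** * Estimates of the commutator uniform on a cube *)

Section commutator_estimates.
Context {R : realType} {n : nat}.
Local Notation mu := (@lebesgue_rV R n).
Local Notation cube r := [set x : 'rV[R]_n | `|x| <= r].

(** Collects the pointwise estimates with constants that depend neither on e nor
on the point of the cube. *)
Lemma commutator_estimates (rho : 'rV[R]_n -> R) (g : 'rV[R]_n -> 'M[R]_n)
    (i l j : 'I_n) (r : R) :
  mollifier rho -> locally_lipschitz g -> (forall x, g x \in unitmx) ->
  exists K1 K2 K3 : R, [/\ 0 <= K1, 0 <= K2, 0 <= K3 &
  \forall e \near 0^'+, forall x, `|x| <= r ->
    mx_convolution g (rescale rho e) x \in unitmx /\
    forall f, locally_bounded f -> exists T : R, [/\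
      is_derive x (delta_mx ord0 j) (fun y =>
        inverse_component (mx_convolution g (rescale rho e)) i l y *
          convolution f (rescale rho e) y -
        convolution (fun y => inverse_component g i l y * f y) (rescale rho e) y) T,
      forall M : R, (forall y, `|f y| <= M) -> `|T| <= K1 * M &
      (`|T|%:E <= (`|f x| * (K2 * e))%:E + (K3 * e ^- n)%:E *
        \int[mu]_z (\1_(cube e) z * `|f (x - z) - f x|)%:E)%E]].
Proof.
move=> mrho lg ug; have [L [d [L0 d0 glip ginv]]] := metric_bounds r lg ug.
have [C C0 approx] := mollifier_approximate_identity j mrho.
pose c := L * C * 2 ^+ n.
have c0 : 0 < c by rewrite !mulr_gt0// exprn_gt0.
pose N : R := n%:R ^+ 2.
have N0 : 0 <= N by rewrite exprn_ge0.
pose C3 := N * (L * (c + L) * L).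
have C30 : 0 <= C3.
  exact: mulr_ge0 N0 (mulr_ge0 (mulr_ge0 (ltW L0) (addr_ge0 (ltW c0) (ltW L0))) (ltW L0)).
have NLL : 0 <= N * (L * c * L).
  exact: mulr_ge0 N0 (mulr_ge0 (mulr_ge0 (ltW L0) (ltW c0)) (ltW L0)).
have K30 : 0 <= (N * (L * c * L) + C3) * C.
  exact: mulr_ge0 (addr_ge0 NLL C30) (ltW C0).
exists ((N * (L * c * L) + C3) * C * 2 ^+ n),
  (2 * N * (C3 * c * L) + N * (N * (L * L * L) * L * L) * C * 2 ^+ n),
  ((N * (L * c * L) + C3) * C); split=> //.
- by rewrite mulr_ge0// exprn_ge0.
- apply: addr_ge0.
    exact: mulr_ge0 (mulr_ge0 (ler0n _ 2) N0) (mulr_ge0 (mulr_ge0 C30 (ltW c0)) (ltW L0)).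
  rewrite mulr_ge0 ?exprn_ge0// mulr_ge0 ?(ltW C0)// mulr_ge0//.
  by rewrite mulr_ge0 ?(ltW L0)// mulr_ge0 ?(ltW L0)// mulr_ge0// !mulr_ge0// ltW.
near=> e.
have e0 : 0 < e by [].
have ed : e < d by near: e; exact: nbhs_right_lt.
have Led : L * e < d.
  by rewrite mulrC -ltr_pdivlMr//; near: e; apply: nbhs_right_lt; rewrite divr_gt0.
have ced : c * e < d.
  by rewrite mulrC -ltr_pdivlMr//; near: e; apply: nbhs_right_lt; rewrite divr_gt0.
move=> x xr; have [w vw] := approx e e0.
have [gl gi] := (glip x xr, ginv x xr).
split; first exact: (mollified_metric_unit lg L0 C0 e0 vw gl gi ed ced).1.
move=> f bf; exists (commutator_deriv g i l (rescale rho e) w x f); split.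
- by have := is_derive_commutator i l lg ug L0 C0 e0 vw gl gi ed ced bf.
- by have := commutator_bounded i l lg ug L0 C0 e0 vw gl gi ed Led ced bf.
- by have := commutator_oscillation i l lg ug L0 C0 e0 vw gl gi ed Led ced bf.
Unshelve. all: by end_near. Qed.

(** Convolutions do not see null sets, so that the essential bound of f may be
taken to hold everywhere. *)
Lemma Linfty_bounded_representative (f : 'rV[R]_n -> R) :
  f \in Lfun mu +oo%E -> exists (f' : 'rV[R]_n -> R) (M : R), [/\ measurable_fun setT f',
    forall x, `|f' x| <= M, measurable_fun setT f & {ae mu, forall x, f x = f' x}].
Proof.
rewrite inE => /andP[/= fm ff].
have mf : measurable_fun setT f by move: fm; rewrite inE.
have [M fM] : exists M : R, {ae mu, forall x, `|f x| <= M}.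
  have : finite_norm mu +oo (f : _ -> _) by move: ff; rewrite inE.
  rewrite /finite_norm unlock; case: ifPn => [_|mu0 _].
    case E : (ess_sup mu _) => [s| |] // _; [exists s|exists 0];
      by apply: filterS (ess_sup_ge mu (abse \o (EFin \o f))) => x; rewrite E /= ?lee_fin ?leeNy_eq.
  exists 0, setT; split=> //; apply/eqP; rewrite eq_le measure_ge0 andbT.
  by rewrite leNgt.
pose f' x := if `|f x| <= M then f x else 0.
exists f', `|M|; split=> //.
- apply: measurable_fun_ifT => //.
  by apply: measurable_fun_ler => //; exact: measurableT_comp.
- move=> x; rewrite /f'; case: ifP => [|_]; last by rewrite normr0.
  by move=> /le_trans; apply; exact: ler_norm.
- by apply: filterS fM => x; rewrite /f' => ->.
Qed.

Lemma ae_eq_convolution (u u' v : 'rV[R]_n -> R) : measurable_fun setT u ->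
  measurable_fun setT u' -> measurable_fun setT v ->
  {ae mu, forall x, u x = u' x} -> convolution u v = convolution u' v.
Proof.
move=> mu1 mu2 mv uu'; apply/funext => x; rewrite /convolution /Rintegral; congr fine.
apply: ae_eq_integral => //.
- by apply/measurable_EFinP; apply: measurable_funM => //; exact: measurable_reflect.
- by apply/measurable_EFinP; apply: measurable_funM => //; exact: measurable_reflect.
by apply: filterS uu' => y -> _.
Qed.

End commutator_estimates.

Lemma cvge0_near_le (T : Type) (F : set_system T) {FF : Filter F} (R : realType) (u : T -> \bar R) :
  (forall d : R, 0 < d -> \forall t \near F, (0 <= u t <= d%:E)%E) -> u t @[t --> F] --> 0%E.
Proof.
move=> ud; have fin : \forall t \near F, u t \is a fin_num.
  apply: filterS (ud 1 ltr01) => t /andP[u0 u1].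
  by rewrite ge0_fin_numE// (le_lt_trans u1)// ltry.
apply/fine_cvgP; split=> //; apply/cvgrPdist_le => d d0.
near=> t; have ut : u t \is a fin_num by near: t.
have /andP[u0 u1] : (0 <= u t <= d%:E)%E by near: t; exact: ud.
by rewrite sub0r normrN /= ger0_norm ?fine_ge0// -lee_fin fineK.
Unshelve. all: by end_near. Qed.

(** * From pointwise bounds to norms *)

Section Lp_convergence.
Context {R : realType} {n : nat}.
Local Notation mu := (@lebesgue_rV R n).
Local Notation cube r := [set x : 'rV[R]_n | `|x| <= r].

Lemma Lnorm_oo_le (u : 'rV[R]_n -> R) (M : R) : 0 <= M -> (forall x, `|u x| <= M) ->
  ('N[mu]_+oo[EFin \o u] <= M%:E)%E.
Proof.
move=> M0 uM; rewrite unlock; case: ifPn => _; last by rewrite lee_fin.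
by apply/ess_supP; apply: aeW => x /=; rewrite lee_fin.
Qed.

(** Interpolation between L^1 and L^oo: |u|^p <= B^(p-1) |u|. The integrable bound
is put on a measurable majorant G of |u|. *)
Lemma Lnorm_le_dominated (u : 'rV[R]_n -> R) (G : 'rV[R]_n -> \bar R) (p B d : R) :
  1 <= p -> 0 < B -> 0 < d -> (forall x, `|u x| <= B) ->
  measurable_fun setT G -> (forall x, (`|u x|%:E <= G x)%E) ->
  (\int[mu]_x G x <= (d `^ p / B `^ (p - 1))%:E)%E ->
  ('N[mu]_(p%:E)[EFin \o u] <= d%:E)%E.
Proof.
move=> p1 B0 d0 uB mG uG Gd; have p0 : 0 < p by exact: lt_le_trans p1.
have Bp : 0 < B `^ (p - 1) by exact: powR_gt0.
have G0 x : (0 <= G x)%E by apply: le_trans (uG x); rewrite lee_fin.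
rewrite unlock.
have I_le : (\int[mu]_x (`|(EFin \o u) x| `^ p) <= (d `^ p)%:E)%E.
  apply: (@le_trans _ _ (\int[mu]_x ((B `^ (p - 1))%:E * G x))%E).
    apply: le_integral_nonneg => x.
    have -> : (`|(EFin \o u) x| `^ p = (`|u x| `^ p)%:E)%E by exact: poweR_EFin.
    rewrite lee_fin powR_ge0/= -mulr_powRB1// mulrC EFinM.
    apply: lee_pmul => //; rewrite ?lee_fin ?powR_ge0//.
    by apply: ge0_ler_powR; rewrite ?nnegrE ?subr_ge0// ltW.
  rewrite ge0_integralZl//; last by rewrite lee_fin ltW.
  rewrite (_ : d `^ p = B `^ (p - 1) * (d `^ p / B `^ (p - 1))); last first.
    by rewrite mulrCA mulfV ?mulr1// gt_eqF.
  by rewrite EFinM lee_wpmul2l// lee_fin ltW.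
have -> : d%:E = ((d `^ p)%:E `^ p^-1)%E.
  by rewrite poweR_EFin -powRrM mulfV ?powRr1 ?gt_eqF// ltW.
apply: gt0_ler_poweR => //; first by rewrite invr_ge0 ltW.
- by rewrite in_itv/= leey andbT integral_ge0// => x _; exact: poweR_ge0.
- by rewrite in_itv/= leey andbT lee_fin powR_ge0.
Qed.

End Lp_convergence.

Theorem lemma3p3 (R : realType) (n : nat)
    (rho : 'rV[R]_n -> R) (rho_mollifier : mollifier rho)
    (g : 'rV[R]_n -> 'M[R]_n)
    (g_lipschitz : locally_lipschitz g)
    (g_lorentzian : forall x, lorentzian_mx (g x))
    (i l : 'I_n)
    (f : 'rV[R]_n -> R)
    (f_Linfty : f \in Lfun (lebesgue_rV n) +oo%E)
    (f_supp : ae_compactly_supported f)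
    (K : set 'rV[R]_n) (K_compact : compact K) (j : 'I_n) :
  let a := inverse_component g i l in
  let g_ (e : R) := mx_convolution g (rescale rho e) in
  let a_ (e : R) := inverse_component (g_ e) i l in
  let h (e : R) (x : 'rV[R]_n) :=
    a_ e x * convolution f (rescale rho e) x
      - convolution (fun y => a y * f y) (rescale rho e) x in
  [/\ \forall e \near 0^'+, exists2 U : set 'rV[R]_n, open U & K `<=` U /\
        forall x, U x ->
          g_ e x \in unitmx /\ derivable (h e) x (delta_mx ord0 j),
      forall p : R, 1 <= p ->
        'N[lebesgue_rV n]_(p%:E)[EFin \o (partial j (h e) \_ K)]%E
          @[e --> 0^'+] --> 0%E
    & exists2 C : R, 0 < C & \forall e \near 0^'+,
        ('N[lebesgue_rV n]_(+oo)[EFin \o (partial j (h e) \_ K)] <= C%:E)%E].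
Proof.
move=> a g_ a_ h.
have ug x : g x \in unitmx by exact: lorentzian_unitmx.
have [r r0 Kr] : exists2 r : R, 0 < r & forall x, K x -> `|x| < r.
  have [M [_ KM]] := compact_bounded K_compact.
  exists (`|M| + 2) => [|x Kx]; first by rewrite ltr_wpDl.
  apply: (@le_lt_trans _ _ (`|M| + 1)); last by rewrite ltrD2l ltr1n.
  by apply: (KM (`|M| + 1)) => //; rewrite (le_lt_trans (ler_norm M))// ltrDl.
have [f' [M [mf' f'M mf ff']]] := Linfty_bounded_representative f_Linfty.
have M0 : 0 <= M by exact: le_trans (normr_ge0 _) (f'M 0).
have bf' : locally_bounded f' by split=> // s; exists M.
have ba := locally_bounded_inverse i l g_lipschitz ug.
have [C kr] := mollifier_kernel rho_mollifier.
(* h and h' are the same function, not merely almost everywhere equal. *)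
pose h' e x := a_ e x * convolution f' (rescale rho e) x
      - convolution (fun y => a y * f' y) (rescale rho e) x.
have hh' e : 0 < e -> h e = h' e.
  move=> e0; have [mv _ _] := rescale_kernel e0 kr.
  have E1 := ae_eq_convolution mf mf' mv ff'.
  have E2 : convolution (fun y => a y * f y) (rescale rho e) =
      convolution (fun y => a y * f' y) (rescale rho e).
    apply: ae_eq_convolution => //.
    - by apply: measurable_funM => //; exact: ba.1.
    - by apply: measurable_funM => //; exact: ba.1.
    - by apply: filterS ff' => x ->.
  by rewrite /h /h' E1 E2.
have [K1 [K2 [K3 [K10 K20 K30 est]]]] :=
  commutator_estimates i l j r rho_mollifier g_lipschitz ug.
have B0 : 0 < K1 * M + 1 by rewrite ltr_wpDl// mulr_ge0.
pose D e x : \bar R := (\int[lebesgue_rV n]_z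
  (\1_[set z : 'rV[R]_n | `|z| <= e]%R z * `|f' (x - z) - f' x|)%:E)%E.
pose near_est e := 0 < e /\ forall x, `|x| <= r -> [/\ g_ e x \in unitmx,
    derivable (h e) x (delta_mx ord0 j), `|partial j (h e) x| <= K1 * M &
    (`|partial j (h e) x|%:E <= (M * (K2 * e))%:E + (K3 * e ^- n)%:E * D e x)%E].
have est' : \forall e \near 0^'+, near_est e.
  have pos : \forall e \near 0^'+, 0 < (e : R) by exact: nbhs_right_gt.
  apply: filterS2 est pos => e He e0; split=> // x xr.
  have [ux /(_ f' bf')[T [dT TM TD]]] := He x xr.
  rewrite hh'//; have [dh hT] := dT; rewrite /partial hT; split=> //; [exact: TM|].
  apply: le_trans TD _; apply: leeD => //.
  by rewrite lee_fin ler_wpM2r// mulr_ge0// ltW.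
have bound e : near_est e -> forall x, `|(partial j (h e) \_ K) x| <= K1 * M + 1.
  move=> [e0 He] x; rewrite patchE; case: ifPn => [|_]; last by rewrite normr0 ltW.
  rewrite inE => /Kr/ltW/He[_ _ + _] => /le_trans; apply.
  by rewrite lerDl.
split.
- apply: filterS est' => e [e0 He].
  exists [set x | `|x| < r].
    rewrite (_ : [set x | _] = (fun x : 'rV[R]_n => `|x|) @^-1` [set t | t < r])//.
    by apply: open_comp => [x _|]; [exact: norm_continuous|exact: open_lt].
  by split=> [x /Kr//|x /= /ltW/He[]].
- move=> p p1; apply: cvge0_near_le => d d0.
  (* The L^1 bound that makes the L^p norm at most d. *)
  pose t := d `^ p / (K1 * M + 1) `^ (p - 1).
  have t0 : 0 < t by rewrite divr_gt0 ?powR_gt0.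
  have k0 : 0 < K3 + 1 by rewrite ltr_wpDl.
  have q0 : 0 < M * K2 * (2 * r) ^+ n + 1.
    by rewrite ltr_wpDl// mulr_ge0 ?exprn_ge0 ?mulr_ge0// ltW.
  have osc := oscillation_cvg0 mf' f'M (ltW r0) (divr_gt0 (divr_gt0 t0 (@ltr0n R 2)) k0).
  near=> e; have He : near_est e by near: e.
  have [e0 He'] := He.
  have oscE : ((e ^- n)%:E * \int[lebesgue_rV n]_(x in [set x : 'rV[R]_n | `|x| <= r]%R) D e x
    <= (t / 2 / (K3 + 1))%:E)%E by near: e; exact: osc.
  have small : M * K2 * e * (2 * r) ^+ n <= t / 2.
    have : e <= t / 2 / (M * K2 * (2 * r) ^+ n + 1).
      by near: e; apply: nbhs_right_le; rewrite divr_gt0// divr_gt0.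
    rewrite ler_pdivlMr// => /(le_trans _); apply.
    by rewrite mulrDr mulr1 -[leLHS]addr0 lerD// ?(ltW e0)// le_eqVlt; apply/orP; left; apply/eqP; ring.
  apply/andP; split; first exact: Lnorm_ge0.
  pose G1 x := ((M * (K2 * e))%:E + (K3 * e ^- n)%:E * D e x)%E.
  pose G := G1 \_ [set x : 'rV[R]_n | `|x| <= r].
  have mcube := measurable_cube (n := n) r.
  have mD : measurable_fun setT (D e) by exact: measurable_oscillation.
  have D0 x : (0 <= D e x)%E by apply: integral_ge0 => z _; rewrite lee_fin mulr_ge0.
  have k1 : 0 <= K3 * e ^- n by rewrite mulr_ge0// invr_ge0 exprn_ge0// ltW.
  have mkD : measurable_fun setT (fun x => (K3 * e ^- n)%:E * D e x)%E by exact: measurable_funeM.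
  have MK0 : 0 <= M * (K2 * e) by rewrite !mulr_ge0// ltW.
  apply: (Lnorm_le_dominated (G := G) p1 B0 d0 (bound e He)).
  - have mG1 : measurable_fun setT G1 by exact: emeasurable_funD.
    by apply: (measurable_restrictT _ mcube).1; exact: measurable_funTS.
  - move=> x; rewrite /G !patchE; case: (boolP (x \in K)) => xK.
      have xr := ltW (Kr _ (set_mem xK)).
      rewrite ifT ?inE//; have [_ _ _] := He' _ xr; exact.
    by rewrite normr0 /G1; case: ifP => // _; rewrite adde_ge0// mule_ge0.
  have mDc : measurable_fun [set x : 'rV[R]_n | `|x| <= r] (D e) by exact: measurable_funTS.
  have kD0 x : (0 <= (K3 * e ^- n)%:E * D e x)%E by rewrite mule_ge0.
  have mkDc := measurable_funTS (D := [set x : 'rV[R]_n | `|x| <= r]) mkD.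
  rewrite -integral_mkcond /G1 ge0_integralD// integral_cst// ge0_integralZl//.
  rewrite [X in (_ * X + _ <= _)%E](lebesgue_rV_cube n (ltW r0)).
  rewrite [(K3 * e ^- n)%:E]EFinM -muleA.
  apply: (@le_trans _ _ ((t / 2)%:E + K3%:E * (t / 2 / (K3 + 1))%:E)%E).
    apply: leeD; last by rewrite lee_wpmul2l.
    by rewrite -EFinM lee_fin mulrA.
  rewrite -EFinM -EFinD lee_fin -/t.
  have : K3 * (t / 2 / (K3 + 1)) <= t / 2.
    rewrite mulrCA; apply: ler_piMr; first by rewrite ltW// divr_gt0.
    by rewrite ler_pdivrMr// mul1r lerDl.
  lra.
- exists (K1 * M + 1) => //; apply: filterS est' => e He.
  by apply: Lnorm_oo_le; [exact: ltW|exact: bound].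
Unshelve. all: by end_near. Qed.
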